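(* Let $(M,g)$ be a connected closed oriented Riemannian $4$-manifold and let $h\in\Omega^0_+(\operatorname{Sym}^2(\Lambda^+))$ be a classical (smooth) solution of $\Phi(h)=0$. Then the $\operatorname{SO}(3)$ connection $A(h)$ on $\Lambda^+$ is irreducible. More precisely, if a smooth section $f\in\Omega^0(\Lambda^+)$ satisfies $d_{A(h)}f=0$, then $f=0$. Moreover, the stabilizer of $A(h)$ in the $\operatorname{SO}(3)$ gauge group is trivial.
   Context: Everything is smooth. $\Lambda^k=\bigwedge^kT^*M$; $\Omega^k(\mathcal{E})$ is the space of smooth $\mathcal{E}$-valued $k$-forms; $\star$ is the Hodge star of $g$, acting on the ordinary form factor of bundle-valued forms; $T^\pm=\frac12(T\pm\star T)$ for a bundle-valued $2$-form $T$. The bundle $\Lambda^+\subset\Lambda^2$ of self-dual $2$-forms ($\star\sigma=\sigma$) has rank three and carries the Euclidean metric induced by $g$ (for an orthonormal co-frame, the $\theta_a\wedge\theta_b$, $a<b$, are orthonormal in $\Lambda^2$). It is oriented by declaring positive the local orthonormal frame $\Sigma_i=-(\theta_0\wedge\theta_i+\theta_j\wedge\theta_k)/\sqrt2$, $(i,j,k)$ a cyclic permutation of $(1,2,3)$, where $(\theta_0,\theta_1,\theta_2,\theta_3)$ is a local oriented orthonormal co-frame. $[-,-]$ denotes the fibrewise cross product on $\Lambda^+$ ($[\Sigma_i,\Sigma_j]=\sum_k\epsilon_{ijk}\Sigma_k$), and $\mathfrak{so}(\Lambda^+)$ is identified with $\Lambda^+$ by letting $f$ correspond to $v\mapsto[f,v]$.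 For $\Lambda^+$-valued forms, $[\sum\alpha_i\otimes\Sigma_i,\sum\beta_j\otimes\Sigma_j]=\sum_{i,j}\alpha_i\wedge\beta_j\otimes[\Sigma_i,\Sigma_j]$. An $\operatorname{SO}(3)$ connection $A$ on $\Lambda^+$ is a metric connection, with exterior covariant derivative $d_A$ and curvature $F_A\in\Omega^2(\Lambda^+)$ (via $\mathfrak{so}(\Lambda^+)\cong\Lambda^+$), so $d_A^2\alpha=[F_A,\alpha]$; for $a\in\Omega^1(\Lambda^+)$, $\nabla^{A+a}v=\nabla^Av+[a,v]$. A $\Lambda^+$-valued self-dual $2$-form $T=\sum_{i,j}T_{ji}\Sigma_j\otimes\Sigma_i$ (first factor: ordinary form; second: coefficient) is regarded as the endomorphism $v\mapsto\sum_{i,j}T_{ji}\langle\Sigma_i,v\rangle\Sigma_j$ of $\Lambda^+$. $\operatorname{Sym}^2(\Lambda^+)$ is the bundle of self-adjoint endomorphisms of $\Lambda^+$, and $\Omega^0_+(\operatorname{Sym}^2(\Lambda^+))$ is the set of its smooth sections $h$ with $h>0$ (positive definite at every point). For an endomorphism field $h$ of $\Lambda^+$, $B_h\in\Omega^2(\Lambda^+)$ is given locally by $B_h=\sum_ih(\Sigma_i)\otimes\Sigma_i$ (first factor: ordinary $2$-form; second: coefficient), for any local oriented orthonormal frame. For $h\in\Omega^0_+(\operatorname{Sym}^2(\Lambda^+))$, $\operatorname{ad}_h\colon\Omega^1(\Lambda^+)\to\Omega^3(\Lambda^+)$, $\operatorname{ad}_h(a)=[a,B_h]$, is invertible, and $A(h):=\Gamma-\operatorname{ad}_h^{-1}(d_\Gamma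 B_h)$, where $\Gamma$ is the connection on $\Lambda^+$ induced by the Levi--Civita connection of $g$. Then $\Phi(h)=\Phi_g(h):=F_{A(h)}^+h^{-1}-\operatorname{Id}$ (composition of endomorphisms), a section of $\operatorname{Sym}^2(\Lambda^+)$. The $\operatorname{SO}(3)$ gauge group consists of the orientation-preserving isometric automorphisms $R$ of $\Lambda^+$ covering $\operatorname{id}_M$; it acts on connections by $\nabla^{R_*A}_Xv=R\nabla^A_X(R^{-1}v)$, and the stabilizer of $A$ is $\{R: R_*A=A\}$. Irreducibility of $A(h)$ is meant in the sense made precise in the claim: there is no non-zero parallel section of $\Lambda^+\cong\mathfrak{so}(\Lambda^+)$. *)

(* Defs.v *)
From mathcomp Require Import all_boot all_order all_algebra all_fingroup.
From mathcomp Require Import all_classical all_reals all_analysis.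

Set Implicit Arguments.
Unset Strict Implicit.
Unset Printing Implicit Defensive.

Import Order.TTheory GRing.Theory Num.Theory.
Import numFieldNormedType.Exports.
Local Open Scope classical_set_scope.
Local Open Scope ring_scope.

Section Smooth.
Variable R : realType.

Definition partial (i : 'I_4) (f : 'rV[R]_4 -> R) : 'rV[R]_4 -> R :=
  fun x => 'D_(delta_mx ord0 i) f x.

(* C^oo on the open set U: all iterated partial derivatives exist and are
   differentiable (hence continuous) at every point of U. *)
Definition smooth_on (U : set 'rV[R]_4) (f : 'rV[R]_4 -> R) : Prop :=
  forall (s : seq 'I_4) (x : 'rV[R]_4), U x -> differentiable (foldr partial f s) x.

Definition smooth_mx_on m n (U : set 'rV[R]_4) (f : 'rV[R]_4 -> 'M[R]_(m, n)) :=
  forall i j, smooth_on U (fun x => f x i j).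

End Smooth.

(* An oriented smooth 4-manifold (without boundary), given by an oriented atlas
   indexed by chart_index: the chart c is the homeomorphism coord c from the open
   set dom c onto an open subset of R^4, and param c is its inverse. *)
Record oriented_manifold4 (R : realType) := OrientedManifold4 {
  points :> topologicalType;
  chart_index : Type;
  dom : chart_index -> set points;
  coord : chart_index -> points -> 'rV[R]_4;
  param : chart_index -> 'rV[R]_4 -> points;
  manifold_hausdorff : hausdorff_space points;
  manifold_second_countable : @second_countable points;
  dom_open : forall c, open (dom c);
  dom_cover : \bigcup_c dom c = setT;
  image_open : forall c, open (coord c @` dom c);
  coordK : forall c p, dom c p -> param c (coord c p) = p;
  coord_continuous : forall c p, dom c p -> {for p, continuous (coord c)};
  param_continuous : forall c x,
    (coord c @` dom c) x -> {for x, continuous (param c)};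
  transition_smooth : forall c c',
    smooth_mx_on (coord c @` (dom c `&` dom c')) (coord c' \o param c);
  transition_oriented : forall c c' x,
    (coord c @` (dom c `&` dom c')) x -> 0 < \det ('J (coord c' \o param c) x)
}.

(* Linear algebra of a 4-dimensional oriented Euclidean space with basis d_0..d_3
   and Gram matrix G.  A 2-form s is the antisymmetric matrix s i j = s(d_i, d_j),
   a covector is a row vector. *)
Section Pointwise.
Variable R : realType.
Implicit Types (G Th s t u v : 'M[R]_4) (L : 'M[R]_4 -> 'M[R]_4).

Definition posdef G : Prop :=
  G^T = G /\ forall v : 'rV[R]_4, v != 0 -> 0 < (v *m G *m v^T) ord0 ord0.

Definition wedge_form (a b : 'rV[R]_4) : 'M[R]_4 := a^T *m b - b^T *m a.

(* The metric induced on 2-forms: (1/2) g^{ik} g^{jl} s_ij t_kl.  It is normalized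
   so that the th_a /\ th_b (a < b) of an orthonormal coframe are orthonormal. *)
Definition ip2 G s t : R := 2^-1 * \tr (s^T *m invmx G *m t *m invmx G).

(* Hodge star on the form factor of W-valued 2-forms:
   (star T)_ij = (1/2) sqrt(det G) eps_{klij} g^{km} g^{ln} T_mn,
   with (k,l,i,j) = (p 0, p 1, p 2, p 3). *)
Definition hodge (W : lmodType R) G (T : 'I_4 -> 'I_4 -> W) (i j : 'I_4) : W :=
  (2^-1 * Num.sqrt (\det G)) *:
    \sum_(p : 'S_4 | (p (inord 2) == i) && (p (inord 3) == j))
      \sum_m \sum_n ((-1) ^+ p * invmx G (p (inord 0)) m * invmx G (p (inord 1)) n)
                     *: T m n.

(* The fibre of Lambda^+: self-dual 2-forms. *)
Definition selfdual G s : Prop :=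
  s^T = - s /\ forall i j, hodge G (fun k l => s k l : R^o) i j = s i j.

(* The rows of Th are an oriented orthonormal coframe th_0, .., th_3:
   g = sum_a th_a (x) th_a. *)
Definition oriented_coframe G Th : Prop := Th^T *m Th = G /\ 0 < \det Th.

(* Sigma_(i+1) = -(th_0 /\ th_i + th_j /\ th_k) / sqrt 2; the addition of 'I_3 is
   modulo 3, so that i, i + 1, i + 2 are cyclically ordered. *)
Definition Sigma_of Th (i : 'I_3) : 'M[R]_4 :=
  let th k := row k Th in
  - (Num.sqrt 2)^-1 *:
    (wedge_form (th ord0) (th (lift ord0 i))
     + wedge_form (th (lift ord0 (i + 1))) (th (lift ord0 (i + 2%:R)))).

(* The frame (Sigma_i) of Lambda^+ for one choice of oriented orthonormal coframe.
   The constructions below do not depend on this choice; in particular they are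
   smooth on coordinate domains although the choice is made point by point. *)
Definition Sigma G : 'I_3 -> 'M[R]_4 :=
  Sigma_of (xget 1%:M [set Th | oriented_coframe G Th]).

(* The cross product: [Sigma_i, Sigma_(i+1)] = Sigma_(i+2). *)
Definition cross G u v : 'M[R]_4 :=
  let c w i := ip2 G (Sigma G i) w in
  \sum_(i < 3) (c u (i + 1) * c v (i + 2%:R) - c u (i + 2%:R) * c v (i + 1))
                 *: Sigma G i.

(* Endomorphisms of Lambda^+ are functions on matrices of which only the values on
   self-dual forms are relevant. *)
Definition endomorphism G L : Prop :=
  (forall s, selfdual G s -> selfdual G (L s)) /\
  (forall (a : R) s t, selfdual G s -> selfdual G t ->
     L (a *: s + t) = a *: L s + L t).

Definition selfadjoint G L : Prop :=
  forall s t, selfdual G s -> selfdual G t -> ip2 G (L s) t = ip2 G s (L t).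

Definition positive G L : Prop :=
  forall s, selfdual G s -> s != 0 -> 0 < ip2 G (L s) s.

Definition endo_inv G L : 'M[R]_4 -> 'M[R]_4 :=
  fun t => xget 0 [set s | selfdual G s /\ L s = t].

(* Special orthogonal transformations of Lambda^+. *)
Definition rotation G L : Prop :=
  [/\ endomorphism G L,
      forall s t, selfdual G s -> selfdual G t -> ip2 G (L s) (L t) = ip2 G s t
    & 0 < \det (\matrix_(i < 3, j < 3) ip2 G (Sigma G i) (L (Sigma G j)))].

(* Lambda^+-valued forms: a 2-form T is the family T i j = T(d_i, d_j) of its
   values in Lambda^+. *)
Definition form1 := 'I_4 -> 'M[R]_4.
Definition form2 := 'I_4 -> 'I_4 -> 'M[R]_4.
Definition form3 := 'I_4 -> 'I_4 -> 'I_4 -> 'M[R]_4.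

Definition sd_part G (T : form2) : form2 :=
  fun i j => 2^-1 *: (T i j + hodge G T i j).

(* The endomorphism v |-> sum_ij T_ji <Sigma_i, v> Sigma_j attached to
   T = sum_ij T_ji Sigma_j (x) Sigma_i is the contraction of v with the coefficient
   factor of T. *)
Definition endo_of G (T : form2) : 'M[R]_4 -> 'M[R]_4 :=
  fun v => \matrix_(k, l) ip2 G (T k l) v.

(* sum_i L(Sigma_i) (x) Sigma_i *)
Definition B_of G L : form2 := fun k l => \sum_(i < 3) L (Sigma G i) k l *: Sigma G i.

(* [a, B](X, Y, Z) is the cyclic sum of [a X, B (Y, Z)]. *)
Definition bracket12 G (a : form1) (B : form2) : form3 := fun i j k =>
  cross G (a i) (B j k) + cross G (a j) (B k i) + cross G (a k) (B i j).

End Pointwise.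

Section Fields.
Variables (R : realType) (M : oriented_manifold4 R).
Local Notation I := (chart_index M).
Local Notation E := 'rV[R]_4.

Definition chart_image (c : I) : set E := coord c @` dom c.
Definition overlap (c c' : I) : set E := coord c @` (dom c `&` dom c').
Definition transition (c c' : I) : E -> E := coord c' \o param c.

(* A tensor field is the family, indexed by the charts, of its components in the
   coordinates; only their values on the image of the chart are relevant, and they
   are subject to the usual transformation law.  In 'J f x the entry (i, j) is
   d_i f_j. *)
Definition tensor2 := I -> E -> 'M[R]_4.
Definition endo_field := I -> E -> 'M[R]_4 -> 'M[R]_4.
Definition form1_field := I -> E -> form1 R.

Definition pull (c c' : I) (x : E) (s : 'M[R]_4) : 'M[R]_4 :=
  let J := 'J (transition c c') x in J *m s *m J^T.

Definition riemannian (g : tensor2) : Prop :=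
  [/\ forall c, smooth_mx_on (chart_image c) (g c),
      forall c x, chart_image c x -> posdef (g c x)
    & forall c c' x, overlap c c' x ->
        g c x = pull c c' x (g c' (transition c c' x))].

Variable g : tensor2.

(* Smooth sections of Lambda^+ over the domain of the chart c. *)
Definition local_section (c : I) (v : E -> 'M[R]_4) : Prop :=
  smooth_mx_on (chart_image c) v /\ forall x, chart_image c x -> selfdual (g c x) (v x).

(* Omega^0(Lambda^+) *)
Definition global_section (f : tensor2) : Prop :=
  (forall c, local_section c (f c)) /\
  (forall c c' x, overlap c c' x ->
     f c x = pull c c' x (f c' (transition c c' x))).

(* Omega^1(Lambda^+) *)
Definition global_form1 (a : form1_field) : Prop :=
  (forall c i, local_section c (fun x => a c x i)) /\
  (forall c c' x i, overlap c c' x ->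
     a c x i = \sum_j 'J (transition c c') x i j *:
                  pull c c' x (a c' (transition c c' x) j)).

(* Smooth sections of End(Lambda^+): they preserve smooth sections of Lambda^+. *)
Definition endo_section (h : endo_field) : Prop :=
  [/\ forall c x, chart_image c x -> endomorphism (g c x) (h c x),
      forall c v, local_section c v -> smooth_mx_on (chart_image c) (fun x => h c x (v x))
    & forall c c' x s, overlap c c' x -> selfdual (g c' (transition c c' x)) s ->
        h c x (pull c c' x s) = pull c c' x (h c' (transition c c' x) s)].

(* Omega^0_+(Sym^2(Lambda^+)) *)
Definition positive_sym2_section (h : endo_field) : Prop :=
  [/\ endo_section h,
      forall c x, chart_image c x -> selfadjoint (g c x) (h c x)
    & forall c x, chart_image c x -> positive (g c x) (h c x)].

(* A connection on Lambda^+ is represented by its covariant derivatives: A c i v is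
   the derivative, along the i-th coordinate vector field of the chart c, of the
   section v of Lambda^+ over the domain of c. *)
Definition connection := I -> 'I_4 -> (E -> 'M[R]_4) -> E -> 'M[R]_4.

Definition christoffel (c : I) (x : E) (l i j : 'I_4) : R :=
  2^-1 * \sum_m invmx (g c x) l m *
    (partial i (fun y => g c y m j) x + partial j (fun y => g c y m i) x
     - partial m (fun y => g c y i j) x).

(* The connection on Lambda^+ induced by the Levi-Civita connection of g, which
   preserves the subbundle Lambda^+ of the 2-forms. *)
Definition Gamma : connection := fun c i v x =>
  \matrix_(k, l) (partial i (fun y => v y k l) x
    - \sum_m christoffel c x m i k * v x m l
    - \sum_m christoffel c x m i l * v x k m).

(* A + a *)
Definition add_form (A : connection) (a : form1_field) : connection :=
  fun c i v x => A c i v x + cross (g c x) (a c x i) (v x).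

(* The exterior covariant derivative d_A on Lambda^+-valued 0-, 1- and 2-forms. *)
Definition d0 (A : connection) (c : I) (v : E -> 'M[R]_4) (x : E) : form1 R :=
  fun i => A c i v x.

Definition d1 (A : connection) (c : I) (a : E -> form1 R) (x : E) : form2 R :=
  fun i j => A c i (fun y => a y j) x - A c j (fun y => a y i) x.

Definition d2 (A : connection) (c : I) (B : E -> form2 R) (x : E) : form3 R :=
  fun i j k => A c i (fun y => B y j k) x + A c j (fun y => B y k i) x
             + A c k (fun y => B y i j) x.

(* F_A(d_i, d_j) is the element w of Lambda^+ such that
   (d_A d_A v)(d_i, d_j) = [w, v] for every section v. *)
Definition curvature (A : connection) (c : I) (x : E) : form2 R := fun i j =>
  xget 0 [set w | selfdual (g c x) w /\
    forall v, local_section c v ->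
      d1 A c (d0 A c v) x i j = cross (g c x) w (v x)].

Definition B_field (h : endo_field) (c : I) (x : E) : form2 R :=
  B_of (g c x) (h c x).

(* The inverse of ad_h : Omega^1(Lambda^+) -> Omega^3(Lambda^+), a |-> [a, B_h]. *)
Definition ad_inv (h : endo_field) (T : I -> E -> form3 R) : form1_field :=
  xget (fun _ _ _ => 0)
    [set a | global_form1 a /\
      forall c x i j k, chart_image c x ->
        bracket12 (g c x) (a c x) (B_field h c x) i j k = T c x i j k].

(* A(h) = Gamma - ad_h^-1 (d_Gamma B_h) *)
Definition A_of (h : endo_field) : connection :=
  let b := ad_inv h (fun c => d2 Gamma c (B_field h c)) in
  add_form Gamma (fun c x i => - b c x i).

(* Phi(h) = F^+_{A(h)} h^-1 - Id *)
Definition Phi (h : endo_field) : endo_field := fun c x v =>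
  endo_of (g c x) (sd_part (g c x) (curvature (A_of h) c x))
    (endo_inv (g c x) (h c x) v) - v.

Definition parallel (A : connection) (f : tensor2) : Prop :=
  forall c x i, chart_image c x -> d0 A c (f c) x i = 0.

Definition irreducible (A : connection) : Prop :=
  forall f, global_section f -> parallel A f -> forall c x, chart_image c x -> f c x = 0.

(* Sections of the bundle of special orthogonal transformations of Lambda^+. *)
Definition gauge_transformation (r : endo_field) : Prop :=
  endo_section r /\ forall c x, chart_image c x -> rotation (g c x) (r c x).

(* r_* A *)
Definition gauge_act (r : endo_field) (A : connection) : connection :=
  fun c i v x => r c x (A c i (fun y => endo_inv (g c y) (r c y) (v y)) x).

(* Equality of connections: equality of the covariant derivatives of all sections
   over coordinate domains. *)
Definition eq_connection (A A' : connection) : Prop :=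
  forall c v, local_section c v ->
    forall i x, chart_image c x -> A c i v x = A' c i v x.

Definition trivial_stabilizer (A : connection) : Prop :=
  forall r, gauge_transformation r -> eq_connection (gauge_act r A) A ->
    forall c x s, chart_image c x -> selfdual (g c x) s -> r c x s = s.

End Fields.

(* Main.v *)
From HB Require Import structures.
Require Import Defs.
From mathcomp Require Import all_boot all_order all_algebra.
From mathcomp Require Import all_classical all_reals all_analysis.
From mathcomp Require Import perm ring lra.

Set Implicit Arguments.
Unset Strict Implicit.
Unset Printing Implicit Defensive.

Import Order.TTheory GRing.Theory Num.Theory.
Import numFieldNormedType.Exports.
Local Open Scope classical_set_scope.
Local Open Scope ring_scope.

(** Why the theorem holds.  Write [F] for the curvature of [A = A(h)] and regard its
    components [F i j] as elements of the fibre of [Lambda^+].  The equation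
    [Phi h = 0] says that [F^+ h^-1] is the identity; hence the endomorphism [F^+] is
    onto, and a tensor of rank three in [Lambda^+ (x) Lambda^+] has rank three with
    respect to either factor, so that the [F i j] span [Lambda^+] at every point
    ([curvature_spans]).

    If [f] is parallel, then [F i j, f] = d_A d_A f = 0, whence [w, f] = 0 for every
    [w] in [Lambda^+], and the cross product is non-degenerate ([A_irreducible]).

    If the gauge transformation [r] fixes [A], it commutes with covariant
    derivatives, hence with the operators [F i j, -], hence with [w, -] for every [w]
    in [Lambda^+].  By Schur's lemma for the adjoint representation [r] is scalar,
    and the only scalar rotation in dimension three is the identity
    ([A_trivial_stabilizer]).

    The argument is pointwise.  What it uses of the geometry is that covariant
    derivatives of sections of [Lambda^+] are again sections, so that the curvature
    can be computed by applying [A] twice: the Levi-Civita connection preserves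
    self-duality ([Gamma_section]), and the cross product, although defined by frames
    that are chosen point by point, is the smooth expression
    [(u g^-1 v - v g^-1 u) / sqrt 2] ([cross_commutator]).  Moreover a section through
    every self-dual form is needed ([section_through]), since the curvature is
    characterized by its action on sections.

    Self-duality is handled through the formula [star s = G (dual s) G / sqrt (det G)]
    ([hodgeE]), where [dual] permutes the entries of [s] up to sign and transforms naturally
    under changes of basis ([dual_congr]); this reduces the algebra of one fibre to
    an orthonormal coframe, where it is an identity between explicit matrices. *)

(** * Coordinates in dimensions three and four *)

Notation o0 := (@Ordinal 4 0 isT).
Notation o1 := (@Ordinal 4 1 isT).
Notation o2 := (@Ordinal 4 2 isT).
Notation o3 := (@Ordinal 4 3 isT).

Notation t0 := (@Ordinal 3 0 isT).
Notation t1 := (@Ordinal 3 1 isT).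
Notation t2 := (@Ordinal 3 2 isT).

Lemma ord4_ind (P : 'I_4 -> Prop) : P o0 -> P o1 -> P o2 -> P o3 -> forall i, P i.
Proof.
move=> P0 P1 P2 P3 [[|[|[|[|//]]]] lti]; by rewrite (bool_irrelevance lti isT).
Qed.

Lemma big_ord4 (T : Type) (idx : T) (op : Monoid.law idx) (F : 'I_4 -> T) :
  \big[op/idx]_(i < 4) F i = op (F o0) (op (F o1) (op (F o2) (F o3))).
Proof.
rewrite !big_ord_recl big_ord0 Monoid.mulm1.
by do !congr (op _ _); congr F; apply: val_inj.
Qed.

Lemma sum4 (V : nmodType) (F : 'I_4 -> V) :
  \sum_(i < 4) F i = F o0 + (F o1 + (F o2 + F o3)).
Proof. exact: big_ord4. Qed.

Lemma ord3_ind (P : 'I_3 -> Prop) : P t0 -> P t1 -> P t2 -> forall i, P i.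
Proof.
move=> P0 P1 P2 [[|[|[|//]]] lti]; by rewrite (bool_irrelevance lti isT).
Qed.

Lemma sum3 (V : nmodType) (F : 'I_3 -> V) :
  \sum_(i < 3) F i = F t0 + (F t1 + F t2).
Proof.
rewrite !big_ord_recl big_ord0 addr0.
by do !congr (_ + _); congr F; apply: val_inj.
Qed.

Lemma addI3 : (((t0 + 1)%R = t1) * ((t1 + 1)%R = t2) * ((t2 + 1)%R = t0)
  * ((t0 + 2%:R)%R = t2) * ((t1 + 2%:R)%R = t0) * ((t2 + 2%:R)%R = t1))%type.
Proof. by do !split; apply: val_inj. Qed.

Section Determinants.
Variable R : comNzRingType.

Lemma det2 (A : 'M[R]_2) : \det A =
  A ord0 ord0 * A (lift ord0 ord0) (lift ord0 ord0)
  - A ord0 (lift ord0 ord0) * A (lift ord0 ord0) ord0.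
Proof.
rewrite (expand_det_row _ ord0) !big_ord_recl big_ord0 /cofactor !det_mx11 !mxE.
have -> : lift (lift ord0 ord0) 0 = ord0 :> 'I_2 by apply: val_inj.
by rewrite /= /bump /=; ring.
Qed.

Lemma det3 (A : 'M[R]_3) : \det A =
  A t0 t0 * (A t1 t1 * A t2 t2 - A t1 t2 * A t2 t1)
- A t0 t1 * (A t1 t0 * A t2 t2 - A t1 t2 * A t2 t0)
+ A t0 t2 * (A t1 t0 * A t2 t1 - A t1 t1 * A t2 t0).
Proof.
rewrite (expand_det_row _ t0) !big_ord_recl big_ord0 /cofactor !det2 !mxE.
have -> : ord0 = t0 by apply: val_inj.
have -> : lift t0 ord0 = t1 by apply: val_inj.
have -> : lift t0 (lift ord0 ord0) = t2 by apply: val_inj.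
have -> : lift t1 ord0 = t0 by apply: val_inj.
have -> : lift t1 (lift ord0 ord0) = t2 by apply: val_inj.
have -> : lift t2 ord0 = t0 by apply: val_inj.
have -> : lift t2 (lift ord0 ord0) = t1 by apply: val_inj.
by rewrite /=; ring.
Qed.

Lemma det4 (A : 'M[R]_4) : \det A =
  A o0 o0 * (A o1 o1 * (A o2 o2 * A o3 o3 - A o2 o3 * A o3 o2)
           - A o1 o2 * (A o2 o1 * A o3 o3 - A o2 o3 * A o3 o1)
           + A o1 o3 * (A o2 o1 * A o3 o2 - A o2 o2 * A o3 o1))
- A o0 o1 * (A o1 o0 * (A o2 o2 * A o3 o3 - A o2 o3 * A o3 o2)
           - A o1 o2 * (A o2 o0 * A o3 o3 - A o2 o3 * A o3 o0)
           + A o1 o3 * (A o2 o0 * A o3 o2 - A o2 o2 * A o3 o0))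
+ A o0 o2 * (A o1 o0 * (A o2 o1 * A o3 o3 - A o2 o3 * A o3 o1)
           - A o1 o1 * (A o2 o0 * A o3 o3 - A o2 o3 * A o3 o0)
           + A o1 o3 * (A o2 o0 * A o3 o1 - A o2 o1 * A o3 o0))
- A o0 o3 * (A o1 o0 * (A o2 o1 * A o3 o2 - A o2 o2 * A o3 o1)
           - A o1 o1 * (A o2 o0 * A o3 o2 - A o2 o2 * A o3 o0)
           + A o1 o2 * (A o2 o0 * A o3 o1 - A o2 o1 * A o3 o0)).
Proof.
rewrite (expand_det_row _ o0) sum4 /cofactor !det3 !mxE.
have l0 : (lift o0 t0 = o1) * (lift o0 t1 = o2) * (lift o0 t2 = o3) by do !split; apply: val_inj.
have l1 : (lift o1 t0 = o0) * (lift o1 t1 = o2) * (lift o1 t2 = o3) by do !split; apply: val_inj.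
have l2 : (lift o2 t0 = o0) * (lift o2 t1 = o1) * (lift o2 t2 = o3) by do !split; apply: val_inj.
have l3 : (lift o3 t0 = o0) * (lift o3 t1 = o1) * (lift o3 t2 = o2) by do !split; apply: val_inj.
by rewrite !l0 !l1 !l2 !l3 /=; ring.
Qed.
End Determinants.

(** * The Hodge star of the standard metric *)

Section Dual.
Variable R : realType.
Implicit Types (s t X P G : 'M[R]_4).

(** The Hodge star of 2-forms for the metric whose Gram matrix is the identity. *)
Definition dual s : 'M[R]_4 := \matrix_(i, j)
  match val i, val j return R with
  | 0%N, 1%N => s o2 o3 | 1%N, 0%N => - s o2 o3
  | 2%N, 3%N => s o0 o1 | 3%N, 2%N => - s o0 o1
  | 0%N, 2%N => - s o1 o3 | 2%N, 0%N => s o1 o3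
  | 1%N, 3%N => - s o0 o2 | 3%N, 1%N => s o0 o2
  | 0%N, 3%N => s o1 o2 | 3%N, 0%N => - s o1 o2
  | 1%N, 2%N => s o0 o3 | 2%N, 1%N => - s o0 o3
  | _, _ => 0
  end.

Lemma antisymE s : s^T = - s ->
  ((s o0 o0 = 0) * (s o1 o1 = 0) * (s o2 o2 = 0) * (s o3 o3 = 0)
  * (s o1 o0 = - s o0 o1) * (s o2 o0 = - s o0 o2) * (s o3 o0 = - s o0 o3)
  * (s o2 o1 = - s o1 o2) * (s o3 o1 = - s o1 o3) * (s o3 o2 = - s o2 o3))%type.
Proof.
move=> sN; have E i j : s i j = - s j i.
  by have /matrixP/(_ j i) := sN; rewrite !mxE.
have E0 i : s i i = 0 by have := E i i; lra.
by do ![split] => //; rewrite ?E0.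
Qed.

Lemma matrix4P (A B : 'M[R]_4) :
  A o0 o0 = B o0 o0 -> A o0 o1 = B o0 o1 -> A o0 o2 = B o0 o2 -> A o0 o3 = B o0 o3 ->
  A o1 o0 = B o1 o0 -> A o1 o1 = B o1 o1 -> A o1 o2 = B o1 o2 -> A o1 o3 = B o1 o3 ->
  A o2 o0 = B o2 o0 -> A o2 o1 = B o2 o1 -> A o2 o2 = B o2 o2 -> A o2 o3 = B o2 o3 ->
  A o3 o0 = B o3 o0 -> A o3 o1 = B o3 o1 -> A o3 o2 = B o3 o2 -> A o3 o3 = B o3 o3 ->
  A = B.
Proof.
move=> *; apply/matrixP; apply: ord4_ind; apply: ord4_ind; by [].
Qed.

Lemma antisym_eq s t : s^T = - s -> t^T = - t ->
  s o0 o1 = t o0 o1 -> s o0 o2 = t o0 o2 -> s o0 o3 = t o0 o3 ->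
  s o1 o2 = t o1 o2 -> s o1 o3 = t o1 o3 -> s o2 o3 = t o2 o3 -> s = t.
Proof.
move=> sN tN E1 E2 E3 E4 E5 E6.
apply: matrix4P; by rewrite ?(antisymE sN) ?(antisymE tN) ?E1 ?E2 ?E3 ?E4 ?E5 ?E6.
Qed.

Lemma dual_antisym s : (dual s)^T = - dual s.
Proof. by apply: matrix4P; rewrite !mxE /= ?oppr0 ?opprK. Qed.

Lemma dualD s t : dual (s + t) = dual s + dual t.
Proof. by apply: matrix4P; rewrite !mxE /= ?opprD ?addr0. Qed.

Lemma dualZ (a : R) s : dual (a *: s) = a *: dual s.
Proof. by apply: matrix4P; rewrite !mxE /= ?mulrN ?mulr0. Qed.

Lemma dualK s : s^T = - s -> dual (dual s) = s.
Proof.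
by move=> sN; apply: antisym_eq; rewrite ?dual_antisym // !mxE /= ?mxE /= ?opprK.
Qed.

Lemma congr_antisym P s : s^T = - s -> (P *m s *m P^T)^T = - (P *m s *m P^T).
Proof. by move=> sN; rewrite !trmx_mul trmxK sN mulmxA mulmxN mulNmx. Qed.

Lemma congrE P s i j : s^T = - s -> (P *m s *m P^T) i j =
    s o0 o1 * (P i o0 * P j o1 - P i o1 * P j o0)
  + s o0 o2 * (P i o0 * P j o2 - P i o2 * P j o0)
  + s o0 o3 * (P i o0 * P j o3 - P i o3 * P j o0)
  + s o1 o2 * (P i o1 * P j o2 - P i o2 * P j o1)
  + s o1 o3 * (P i o1 * P j o3 - P i o3 * P j o1)
  + s o2 o3 * (P i o2 * P j o3 - P i o3 * P j o2).
Proof. by move=> sN; rewrite !(mxE, sum4) !(antisymE sN); ring. Qed.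

Lemma dualE s :
  ((dual s o0 o1 = s o2 o3) * (dual s o0 o2 = - s o1 o3) * (dual s o0 o3 = s o1 o2)
  * (dual s o1 o2 = s o0 o3) * (dual s o1 o3 = - s o0 o2)
  * (dual s o2 o3 = s o0 o1))%type.
Proof. by rewrite !mxE. Qed.

(** [dual s] is the bivector that corresponds to [s] under contraction with the
    volume form, and [P] multiplies the volume form by its determinant. *)
Lemma dual_congr P s : s^T = - s ->
  P^T *m dual (P *m s *m P^T) *m P = \det P *: dual s.
Proof.
move=> sN; rewrite det4.
apply: antisym_eq.
- by have := congr_antisym P^T (dual_antisym (P *m s *m P^T)); rewrite trmxK.
- by rewrite linearZ /= dual_antisym scalerN.
all: have := congrE P^T _ _ (dual_antisym (P *m s *m P^T)); rewrite trmxK => ->.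
all: by rewrite [RHS]mxE !dualE !congrE // !mxE; ring.
Qed.

(** The infinitesimal form of [dual_congr], at [P = 1 + e X] with [e ^+ 2 = 0]. *)
Lemma dual_lie X s : s^T = - s ->
  dual (X *m s + s *m X^T) = \tr X *: dual s - X^T *m dual s - dual s *m X.
Proof.
move=> sN; rewrite /mxtrace.
apply: antisym_eq; first exact: dual_antisym.
  rewrite !linearB linearZ /= !trmx_mul trmxK dual_antisym.
  by rewrite mulNmx mulmxN scalerN addrAC.
all: by rewrite dualE !(mxE, sum4) /= !(antisymE sN); ring.
Qed.

End Dual.

(** * The Hodge star of a metric *)

Section HodgeStar.
Variable R : realType.
Implicit Types (s t X P G Th : 'M[R]_4).

Lemma inord4 :
  ((inord 0 = o0) * (inord 1 = o1) * (inord 2 = o2) * (inord 3 = o3))%type.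
Proof. by do !split; apply: val_inj; rewrite /= inordK. Qed.

(** The determinant of four standard basis vectors is the sign of the permutation
    that they form; its polynomial expansion [det4] evaluates the sum over ['S_4] in
    the Hodge star without an enumeration of the permutations. *)
Definition levi_civita (a b c d : 'I_4) : R := \det (\matrix_(i < 4, j < 4)
  ((match val i with 0%N => a | 1%N => b | 2%N => c | _ => d end) == j)%:R).

Lemma levi_civitaE a b c d :
  levi_civita a b c d = \sum_(p : 'S_4) (-1) ^+ p *
     (((a == p o0)%:R * (b == p o1)%:R) * ((c == p o2)%:R * (d == p o3)%:R)).
Proof.
rewrite /levi_civita /determinant; apply: eq_bigr => p _; congr (_ * _).
by rewrite (big_ord4 _ (fun i => _ i (p i))) !mxE /= !mulrA.
Qed.

Lemma levi_civita_sum (Q : 'M[R]_4) (i j : 'I_4) :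
  \sum_(p : 'S_4 | (p o2 == i) && (p o3 == j)) (-1) ^+ p * Q (p o0) (p o1)
  = \sum_k \sum_l levi_civita k l i j * Q k l.
Proof.
under [RHS]eq_bigr => k _ do under eq_bigr => l _ do rewrite levi_civitaE mulr_suml.
under [RHS]eq_bigr => k _ do rewrite exchange_big /=.
rewrite exchange_big /= [RHS](bigID (fun p : 'S_4 => (p o2 == i) && (p o3 == j))) /=.
rewrite [X in _ = _ + X]big1 ?addr0 => [|p]; last first.
  move=> /negPf pN; rewrite big1 // => k _; rewrite big1 // => l _.
  rewrite (eq_sym i) (eq_sym j) -[X in (_ * (_ * X))]natrM mulnb pN.
  by rewrite !mulr0 mul0r.
apply: eq_bigr => p /andP[/eqP <- /eqP <-].
rewrite (bigD1 (p o0)) //= [X in _ = _ + X]big1 ?addr0 => [|k /negPf kN]; last first.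
  by rewrite big1 // => l _; rewrite kN !(mul0r, mulr0).
rewrite (bigD1 (p o1)) //= [X in _ = _ + X]big1 ?addr0 => [|k /negPf kN]; last first.
  by rewrite kN !(mul0r, mulr0).
by rewrite !eqxx !mulr1.
Qed.

Lemma levi_civita_dual s i j : s^T = - s ->
  2^-1 * (\sum_k \sum_l levi_civita k l i j * s k l) = dual s i j.
Proof.
move=> sN.
pose simpE := (mul0r, mulr0, add0r, addr0, subr0, sub0r, mul1r, mulr1, oppr0).
move: i j; apply: ord4_ind; apply: ord4_ind.
all: under eq_bigr => k _ do under eq_bigr => l _ do rewrite /levi_civita det4 !mxE /= !simpE.
all: rewrite !sum4 /= !simpE !mxE /= ?(antisymE sN).
all: by field.
Qed.

(** Elimination of the first row and column leaves the Schur complement of the corner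
    entry, which is again positive definite. *)
Lemma cholesky n (G : 'M[R]_n) : G^T = G ->
  (forall v : 'rV[R]_n, v != 0 -> 0 < (v *m G *m v^T) ord0 ord0) ->
  exists L : 'M[R]_n, L^T *m L = G /\ 0 < \det L.
Proof.
elim: n G => [|n IH].
  move=> G _ _; by exists 1%:M; rewrite det1 ltr01; split=> //; apply/matrixP => -[].
rewrite -[n.+1]/(1 + n)%N => G; rewrite -(submxK G).
set a := ulsubmx G; set b := ursubmx G; set D := drsubmx G.
rewrite tr_block_mx => /eq_block_mx[_ _ bE DE]; rewrite -bE => Gpos.
have aE : a = (a 0 0)%:M by rewrite [LHS]mx11_scalar.
have a_gt0 : 0 < a 0 0.
  have /Gpos : (row_mx 1%:M 0 : 'rV[R]_(1 + n)) != 0.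
    apply/eqP => /(congr1 lsubmx); rewrite row_mxKl linear0 => /matrixP/(_ 0 0).
    by rewrite !mxE eqxx => /eqP; rewrite oner_eq0.
  rewrite mul_row_block tr_row_mx mul_row_col trmx1 trmx0 !mul0mx !addr0.
  by rewrite mulmx0 addr0 mul1mx mulmx1.
pose S := D - (a 0 0)^-1 *: (b^T *m b).
have [||L [TE T_gt0]] := IH S.
- by rewrite /S linearB /= DE linearZ /= trmx_mul trmxK.
- move=> w w0.
  (* [row_mx c w] minimizes the quadratic form of [G] over the first coordinate *)
  pose c := - (a 0 0)^-1 *: (w *m b^T).
  have /Gpos : (row_mx c w : 'rV[R]_(1 + n)) != 0.
    apply: contra w0 => /eqP/(congr1 rsubmx); rewrite row_mxKr => ->.
    by rewrite linear0.
  rewrite mul_row_block tr_row_mx mul_row_col aE mul_mx_scalar.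
  rewrite {1}/c scalerA mulrN divff ?gt_eqF // scaleN1r addNr mul0mx add0r.
  by rewrite /S mulmxBr /c -scalemxAr -!scalemxAl mulmxA scaleNr addrC.
exists (block_mx (Num.sqrt (a 0 0))%:M ((Num.sqrt (a 0 0))^-1 *: b) 0 L : 'M[R]_(1 + n)).
have sq : Num.sqrt (a 0 0) * Num.sqrt (a 0 0) = a 0 0 by rewrite -expr2 sqr_sqrtr ?ltW.
have s0 : Num.sqrt (a 0 0) != 0 by rewrite gt_eqF ?sqrtr_gt0.
split; last by rewrite det_ublock det_scalar1 mulr_gt0 ?sqrtr_gt0.
rewrite tr_block_mx mulmx_block trmx0 !mul0mx mulmx0 !addr0.
rewrite tr_scalar_mx -scalar_mxM sq -aE mul_scalar_mx scalerA mulfV // scale1r.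
rewrite linearZ /= mul_mx_scalar scalerA mulfV // scale1r TE.
by rewrite -scalemxAl -scalemxAr scalerA -invfM sq /S addrC subrK.
Qed.

Lemma coframe_exists G : posdef G -> exists Th, oriented_coframe G Th.
Proof. by case=> Gsym Gpos; have [Th ThP] := cholesky Gsym Gpos; exists Th. Qed.

Lemma posdef_det G : posdef G -> 0 < \det G.
Proof.
by move=> /coframe_exists[Th [<- d0]]; rewrite det_mulmx det_tr mulr_gt0.
Qed.

Lemma posdef_unit G : posdef G -> G \in unitmx.
Proof. by move=> /posdef_det d0; rewrite unitmxE unitfE gt_eqF. Qed.

Lemma invmx_sym G : G^T = G -> (invmx G)^T = invmx G.
Proof. by move=> Gsym; rewrite trmx_inv Gsym. Qed.

(** Raising both indices of [s] is a congruence by [invmx G], whose effect on [dual]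
    is given by [dual_congr]. *)
Lemma hodgeE G s i j : posdef G -> s^T = - s ->
  hodge G (fun k l => s k l : R^o) i j =
  ((Num.sqrt (\det G))^-1 *: (G *m dual s *m G)) i j.
Proof.
move=> Gpos sN; have Gsym := proj1 Gpos; have d0 := posdef_det Gpos.
have Gu := posdef_unit Gpos.
have QN := congr_antisym (invmx G) sN.
have := dual_congr (invmx G) sN.
rewrite invmx_sym // in QN *; set Q := invmx G *m s *m invmx G in QN *.
move=> /(congr1 (fun A => G *m A *m G)).
rewrite !mulmxA mulmxV // mul1mx mulmxKV // det_inv => dQ.
rewrite mxE -[(G *m _ *m G) i j](mulVKf (lt0r_neq0 d0)) mulrA.
have -> : (\det G)^-1 * (G *m dual s *m G) i j = dual Q i j.
  by rewrite dQ -scalemxAr -scalemxAl [RHS]mxE.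
have -> : (Num.sqrt (\det G))^-1 * \det G = Num.sqrt (\det G).
  by rewrite -{2}(sqr_sqrtr (ltW d0)) expr2 mulKf // gt_eqF ?sqrtr_gt0.
rewrite -(levi_civita_dual _ _ QN) -levi_civita_sum /hodge.
rewrite [in LHS]/GRing.scale [LHS]/= -mulrA mulrCA; congr (_ * (_ * _)).
rewrite !inord4; apply: eq_bigr => p _.
rewrite /Q mxE mulr_sumr exchange_big /=; apply: eq_bigr => n _.
rewrite mxE mulr_suml mulr_sumr; apply: eq_bigr => m _.
have -> : invmx G n (p o1) = invmx G (p o1) n by rewrite -{1}(invmx_sym Gsym) mxE.
by rewrite -[LHS]/(_ * _) -!mulrA; congr (_ * (_ * _)); apply: mulrC.
Qed.

(** Free of inverses, this form of self-duality can be differentiated. *)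
Lemma selfdualE G s : posdef G ->
  selfdual G s <-> s^T = - s /\ G *m dual s *m G = Num.sqrt (\det G) *: s.
Proof.
move=> Gpos; have d0 : Num.sqrt (\det G) != 0 by rewrite gt_eqF ?sqrtr_gt0 ?posdef_det.
split=> -[sN E]; split=> //.
  have Es : s = (Num.sqrt (\det G))^-1 *: (G *m dual s *m G).
    by apply/matrixP => i j; rewrite -hodgeE.
  by rewrite [X in _ = _ *: X]Es scalerA mulfV // scale1r.
by move=> i j; rewrite hodgeE // E scalerA mulVf // scale1r.
Qed.

End HodgeStar.

(** * The frame of self-dual forms *)

Section Frame.
Variable R : realType.
Implicit Types (s t u v X P G Th : 'M[R]_4).

Let q : R := (Num.sqrt 2)^-1.

Lemma invsqrt2_sq : q * q = 2^-1.
Proof. by rewrite -invfM -expr2 sqr_sqrtr ?ler0n. Qed.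

Lemma selfdual_entries s : s^T = - s -> dual s = s ->
  ((s o2 o3 = s o0 o1) * (s o1 o3 = - s o0 o2) * (s o1 o2 = s o0 o3))%type.
Proof.
by move=> sN sd; rewrite -{1}sd -{3}sd -{5}sd !dualE.
Qed.

(** Locked, because rewriting with the laws of scaling would otherwise see through
    the name. *)
Definition stdSigma : 'I_3 -> 'M[R]_4 := locked (Sigma_of 1%:M).

Lemma stdSigma_def i : stdSigma i = Sigma_of 1%:M i.
Proof. by rewrite /stdSigma -lock. Qed.

Lemma wedge_antisym (a b : 'rV[R]_4) : (wedge_form a b)^T = - wedge_form a b.
Proof. by rewrite /wedge_form linearB /= !trmx_mul !trmxK opprB. Qed.

Lemma stdSigma_antisym i : (stdSigma i)^T = - stdSigma i.
Proof.
by rewrite stdSigma_def /Sigma_of linearZ linearD /= !wedge_antisym -opprD scalerN.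
Qed.

Lemma liftI3 : ((lift ord0 t0 = o1) * (lift ord0 t1 = o2) * (lift ord0 t2 = o3))%type.
Proof. by do !split; apply: val_inj. Qed.

Lemma stdSigmaE :
  ((stdSigma t0 o0 o1 = - q) * (stdSigma t0 o0 o2 = 0) * (stdSigma t0 o0 o3 = 0)
 * (stdSigma t0 o1 o2 = 0) * (stdSigma t0 o1 o3 = 0) * (stdSigma t0 o2 o3 = - q)
 * (stdSigma t1 o0 o1 = 0) * (stdSigma t1 o0 o2 = - q) * (stdSigma t1 o0 o3 = 0)
 * (stdSigma t1 o1 o2 = 0) * (stdSigma t1 o1 o3 = q) * (stdSigma t1 o2 o3 = 0)
 * (stdSigma t2 o0 o1 = 0) * (stdSigma t2 o0 o2 = 0) * (stdSigma t2 o0 o3 = - q)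
 * (stdSigma t2 o1 o2 = - q) * (stdSigma t2 o1 o3 = 0) * (stdSigma t2 o2 o3 = 0))%type.
Proof.
rewrite !stdSigma_def /Sigma_of /wedge_form -/q !addI3 !liftI3.
by do !split; rewrite !(mxE, big_ord_recl, big_ord0) /=; ring.
Qed.

Lemma dual_stdSigma i : dual (stdSigma i) = stdSigma i.
Proof.
apply: antisym_eq; rewrite ?dual_antisym ?stdSigma_antisym // dualE.
all: by move: i; apply: ord3_ind; rewrite !stdSigmaE ?opprK ?oppr0.
Qed.

Lemma trace_antisym s t : s^T = - s -> t^T = - t -> 2^-1 * \tr (s^T *m t) =
    s o0 o1 * t o0 o1 + s o0 o2 * t o0 o2 + s o0 o3 * t o0 o3
  + s o1 o2 * t o1 o2 + s o1 o3 * t o1 o3 + s o2 o3 * t o2 o3.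
Proof.
move=> sN tN; rewrite sN mulNmx /mxtrace !(mxE, sum4) !(antisymE sN) !(antisymE tN).
by field.
Qed.

(** The two halves of a self-dual form contribute equally to the inner product. *)
Lemma coord_stdSigma s i : s^T = - s -> dual s = s ->
  2^-1 * \tr ((stdSigma i)^T *m s) = - 2 * q * s o0 (lift ord0 i).
Proof.
move=> sN sd; rewrite trace_antisym ?stdSigma_antisym // !(selfdual_entries sN sd).
by move: i; apply: ord3_ind; rewrite liftI3 !stdSigmaE; lra.
Qed.

Lemma stdSigma_orthonormal i j : 2^-1 * \tr ((stdSigma i)^T *m stdSigma j) = (i == j)%:R.
Proof.
rewrite (coord_stdSigma _ (stdSigma_antisym j) (dual_stdSigma j)).
have := invsqrt2_sq.
by move: i j; apply: ord3_ind; apply: ord3_ind; rewrite liftI3 !stdSigmaE ?mulr0 //=; lra.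
Qed.

Lemma entD s t i j : (s + t) i j = s i j + t i j. Proof. by rewrite mxE. Qed.
Lemma entN s i j : (- s) i j = - s i j. Proof. by rewrite mxE. Qed.
Lemma entZ (a : R) s i j : (a *: s) i j = a * s i j. Proof. by rewrite mxE. Qed.
Lemma entM s t i j : (s *m t) i j = \sum_k s i k * t k j. Proof. by rewrite mxE. Qed.

Lemma antisymD s t : s^T = - s -> t^T = - t -> (s + t)^T = - (s + t).
Proof. by move=> sN tN; rewrite linearD /= sN tN opprD. Qed.

Lemma antisymZ (a : R) s : s^T = - s -> (a *: s)^T = - (a *: s).
Proof. by move=> sN; rewrite linearZ /= sN scalerN. Qed.

Lemma stdSigma_expand s : s^T = - s -> dual s = s ->
  s = \sum_i (2^-1 * \tr ((stdSigma i)^T *m s)) *: stdSigma i.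
Proof.
move=> sN sd; rewrite sum3 !coord_stdSigma // !liftI3.
have E (x : R) : - 2 * q * x * - q = x.
  have -> : - 2 * q * x * - q = 2 * (q * q) * x by ring.
  by rewrite invsqrt2_sq; lra.
have SN := stdSigma_antisym; apply: antisym_eq => //.
  by apply: antisymD; [|apply: antisymD]; apply: antisymZ; apply: stdSigma_antisym.
all: have := E (s o0 o1); have := E (s o0 o2); have := E (s o0 o3).
all: by rewrite !(entD, entZ) !stdSigmaE ?(selfdual_entries sN sd); lra.
Qed.

(** The matrices [- sqrt 2 *: stdSigma i] multiply as the imaginary units of the
    quaternions, up to the order of the factors. *)
Lemma stdSigma_bracket u v : u^T = - u -> dual u = u -> v^T = - v -> dual v = v ->
  let c w i := 2^-1 * \tr ((stdSigma i)^T *m w) in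
  \sum_(i < 3) (c u (i + 1) * c v (i + 2%:R) - c u (i + 2%:R) * c v (i + 1)) *: stdSigma i
  = q *: (u *m v - v *m u).
Proof.
move=> uN ud vN vd /=; rewrite sum3 !coord_stdSigma // !addI3 !liftI3.
have E (a b x y : R) : - 2 * q * a * (- 2 * q * b) - - 2 * q * x * (- 2 * q * y)
    = (a * b - x * y) * 2.
  transitivity ((a * b - x * y) * (4 * (q * q))); first by ring.
  by rewrite invsqrt2_sq; congr (_ * _); lra.
rewrite !E; have SN := stdSigma_antisym; apply: antisym_eq.
- by apply: antisymD; [|apply: antisymD]; apply: antisymZ; apply: stdSigma_antisym.
- by apply: antisymZ; rewrite linearB /= !trmx_mul uN vN !mulmxN !mulNmx !opprK opprB.
all: rewrite !(entD, entN, entZ, entM) !stdSigmaE !sum4.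
all: rewrite !(antisymE uN) !(antisymE vN) ?(selfdual_entries uN ud)
  ?(selfdual_entries vN vd); ring.
Qed.

End Frame.

(** * The Euclidean structure of the fibre *)

Section Coframe.
Variable R : realType.
Implicit Types (s t u v X P G Th : 'M[R]_4) (L : 'M[R]_4 -> 'M[R]_4).

Lemma coframe_unit G Th : oriented_coframe G Th -> Th \in unitmx.
Proof. by case=> _ d0; rewrite unitmxE unitfE gt_eqF. Qed.

Lemma coframe_inv G Th : oriented_coframe G Th ->
  invmx G = invmx Th *m (invmx Th)^T.
Proof.
move=> ThP; have Thu := coframe_unit ThP; case: ThP => <- _.
have TTu : Th^T \in unitmx by rewrite unitmx_tr.
have Gu : Th^T *m Th \in unitmx by rewrite unitmx_mul TTu.
apply: (can_inj (mulKmx Gu)); rewrite mulmxV // -mulmxA (mulmxA Th) mulmxV //.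
by rewrite mul1mx trmx_inv mulmxV.
Qed.

Lemma Sigma_of_congr Th i : Sigma_of Th i = Th^T *m stdSigma R i *m Th.
Proof.
have wE (a b : 'rV_4) : wedge_form (a *m Th) (b *m Th) = Th^T *m wedge_form a b *m Th.
  by rewrite /wedge_form !trmx_mul mulmxBr mulmxBl !mulmxA.
have rE k : row k Th = row k 1%:M *m Th by rewrite -row_mul mul1mx.
rewrite stdSigma_def /Sigma_of !(rE _) !wE -scalemxAr -scalemxAl; congr (_ *: _).
by rewrite -mulmxDl -mulmxDr.
Qed.

Lemma ip2_congr G Th s t : oriented_coframe G Th ->
  ip2 G (Th^T *m s *m Th) (Th^T *m t *m Th) = 2^-1 * \tr (s^T *m t).
Proof.
move=> ThP; have Thu := coframe_unit ThP; have TTu : Th^T \in unitmx by rewrite unitmx_tr.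
rewrite /ip2 (coframe_inv ThP) !trmx_mul trmxK trmx_inv; congr (_ * _).
rewrite !mulmxA mulmxK // mulmxKV // mulmxK //.
by rewrite mxtrace_mulC !mulmxA mulVmx // mul1mx.
Qed.

Lemma selfdual_congr G Th s : posdef G -> oriented_coframe G Th ->
  selfdual G (Th^T *m s *m Th) <-> s^T = - s /\ dual s = s.
Proof.
move=> Gpos ThP; have Thu := coframe_unit ThP; have TTu : Th^T \in unitmx by rewrite unitmx_tr.
case: ThP => ThG d0.
have sq : Num.sqrt (\det G) = \det Th.
  by rewrite -ThG det_mulmx det_tr -expr2 sqrtr_sqr gtr0_norm.
have aE : (Th^T *m s *m Th)^T = - (Th^T *m s *m Th) <-> s^T = - s.
  split=> [|sN]; last by have := congr_antisym Th^T sN; rewrite trmxK.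
  rewrite !trmx_mul trmxK mulmxA -mulNmx -mulmxN.
  by move/(can_inj (mulmxK Thu))/(can_inj (mulKmx TTu)).
rewrite (selfdualE _ Gpos) aE sq.
split=> -[sN E]; split=> //.
- move: E; have := dual_congr Th^T sN; rewrite trmxK det_tr.
  move=> /(congr1 (fun A => Th^T *m A *m Th)).
  rewrite !mulmxA ThG -(mulmxA _ Th^T) ThG => -> /esym.
  rewrite -scalemxAr -scalemxAl => /(scalerI (lt0r_neq0 d0)).
  by move/(can_inj (mulmxK Thu))/(can_inj (mulKmx TTu)).
- have := dual_congr Th^T sN; rewrite trmxK det_tr.
  move=> /(congr1 (fun A => Th^T *m A *m Th)).
  rewrite !mulmxA ThG -(mulmxA _ Th^T) ThG => ->.
  by rewrite E -scalemxAr -scalemxAl.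
Qed.

Section Fibre.
Variable G : 'M[R]_4.
Hypothesis Gpos : posdef G.

Let Th := xget 1%:M [set Th | oriented_coframe G Th].

Let ThP : oriented_coframe G Th.
Proof. by have [T0 T0P] := coframe_exists Gpos; apply: (xgetI _ T0P). Qed.

Let SigmaE i : Sigma G i = Th^T *m stdSigma R i *m Th.
Proof. exact: Sigma_of_congr. Qed.

Let congr_ex s : exists t, s = Th^T *m t *m Th.
Proof.
have Thu := coframe_unit ThP; have TTu : Th^T \in unitmx by rewrite unitmx_tr.
by exists (invmx Th^T *m s *m invmx Th); rewrite !mulmxA mulmxV // mul1mx mulmxKV.
Qed.

Lemma Sigma_selfdual i : selfdual G (Sigma G i).
Proof.
rewrite SigmaE selfdual_congr //.
by split; [apply: stdSigma_antisym|apply: dual_stdSigma].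
Qed.

Lemma Sigma_orthonormal i j : ip2 G (Sigma G i) (Sigma G j) = (i == j)%:R.
Proof. by rewrite !SigmaE ip2_congr // stdSigma_orthonormal. Qed.

Lemma Sigma_expand s : selfdual G s -> s = \sum_i ip2 G (Sigma G i) s *: Sigma G i.
Proof.
have [t ->] := congr_ex s; rewrite selfdual_congr // => -[tN td].
under eq_bigr => i _ do rewrite SigmaE ip2_congr // scalemxAl scalemxAr.
by rewrite -mulmx_suml -mulmx_sumr -stdSigma_expand.
Qed.

(** Self-dual forms act on the tangent space as imaginary quaternions, so that
    their cross product is a commutator. *)
Lemma cross_commutator u v : selfdual G u -> selfdual G v ->
  cross G u v = (Num.sqrt 2)^-1 *: (u *m invmx G *m v - v *m invmx G *m u).
Proof.
have Thu := coframe_unit ThP; have TTu : Th^T \in unitmx by rewrite unitmx_tr.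
have [s ->] := congr_ex u; have [t ->] := congr_ex v.
rewrite !selfdual_congr // => -[sN sd] -[tN td].
rewrite (coframe_inv ThP) trmx_inv !mulmxA !mulmxK // !mulmxKV //.
rewrite -(mulmxA Th^T s t) -(mulmxA Th^T t s) -mulmxBl -mulmxBr.
rewrite scalemxAl scalemxAr -stdSigma_bracket // /cross.
rewrite mulmx_sumr mulmx_suml; apply: eq_bigr => i _.
by rewrite !SigmaE !ip2_congr // -scalemxAr -scalemxAl.
Qed.

End Fibre.
End Coframe.

(** * Spanning and Schur's lemma *)

Section FibreEndomorphisms.
Variable R : realType.
Implicit Types (s t u v w X P G Th : 'M[R]_4) (L : 'M[R]_4 -> 'M[R]_4).

Definition linear_subspace (P : 'M[R]_4 -> Prop) : Prop :=
  P 0 /\ forall (a : R) s t, P s -> P t -> P (a *: s + t).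

Section Subspace.
Variables (P : 'M[R]_4 -> Prop) (PP : linear_subspace P).

Lemma subspaceZ (a : R) s : P s -> P (a *: s).
Proof. by case: PP => P0 PD Ps; rewrite -[a *: s]addr0; apply: PD. Qed.

Lemma subspaceD s t : P s -> P t -> P (s + t).
Proof. by case: PP => P0 PD Ps Pt; rewrite -[s]scale1r; apply: PD. Qed.

Lemma subspace_sum I (r : seq I) (Q : pred I) (F : I -> 'M[R]_4) :
  (forall i, Q i -> P (F i)) -> P (\sum_(i <- r | Q i) F i).
Proof. by move=> PF; elim/big_ind: _ => //; [case: PP|apply: subspaceD]. Qed.

Lemma subspace_sd_part G (T : form2 R) k l :
  (forall i j, P (T i j)) -> P (sd_part G T k l).
Proof.
move=> PT; apply/subspaceZ/subspaceD => //; apply/subspaceZ.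
by do 3![apply: subspace_sum => ? _]; apply: subspaceZ.
Qed.
End Subspace.

Lemma ip2_linear G s : linear (ip2 G s : _ -> R^o).
Proof.
move=> a t u; rewrite /ip2 mulmxDr mulmxDl -scalemxAr -scalemxAl mxtraceD mxtraceZ.
by rewrite mulrDr mulrCA.
Qed.
HB.instance Definition _ G s :=
  GRing.isLinear.Build R 'M[R]_4 R^o _ (ip2 G s) (ip2_linear G s).

Lemma ip2Zr G s (a : R) t : ip2 G s (a *: t) = a * ip2 G s t.
Proof. exact: linearZ. Qed.

Lemma ip2Pr G s (a : R) t u : ip2 G s (a *: t + u) = a * ip2 G s t + ip2 G s u.
Proof. exact: linearP. Qed.

Lemma ip20r G s : ip2 G s 0 = 0.
Proof. exact: linear0. Qed.

Lemma ip2C G s t : G^T = G -> ip2 G s t = ip2 G t s.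
Proof.
move=> Gsym; rewrite /ip2; congr (_ * _); rewrite -[RHS]mxtrace_tr !trmx_mul !trmxK.
by rewrite !invmx_sym // [RHS]mxtrace_mulC !mulmxA mxtrace_mulC !mulmxA.
Qed.

Lemma ip2_sum G s : exists K : 'M[R]_4, forall t, ip2 G s t = \sum_a \sum_b K a b * t b a.
Proof.
exists ((2^-1 *: invmx G) *m s^T *m invmx G) => t'.
rewrite /ip2 mxtrace_mulC !mulmxA -mxtraceZ !scalemxAl /mxtrace.
by apply: eq_bigr => a _; rewrite mxE.
Qed.

Section Posdef.
Variable G : 'M[R]_4.
Hypothesis Gpos : posdef G.
Let Gsym : G^T = G := proj1 Gpos.

Lemma subspace_selfdual : linear_subspace (selfdual G).
Proof.
split=> [|a s t]; rewrite !selfdualE //.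
  have d0 : dual (0 : 'M[R]_4) = 0 by rewrite -[0](scale0r 0) dualZ !scale0r.
  by rewrite trmx0 oppr0 d0 mulmx0 mul0mx scaler0.
move=> [sN sd] [tN td]; split; first by apply: antisymD => //; apply: antisymZ.
rewrite dualD dualZ mulmxDr mulmxDl -scalemxAr -scalemxAl sd td.
by rewrite scalerDr !scalerA mulrC.
Qed.

Lemma selfdual0 : selfdual G 0. Proof. exact: (proj1 subspace_selfdual). Qed.

Lemma selfdualZ (a : R) s : selfdual G s -> selfdual G (a *: s).
Proof. exact: subspaceZ subspace_selfdual _ _. Qed.

Lemma selfdualD s t : selfdual G s -> selfdual G t -> selfdual G (s + t).
Proof. exact: subspaceD subspace_selfdual _ _. Qed.

Lemma selfdualN s : selfdual G s -> selfdual G (- s).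
Proof. by move=> ssd; rewrite -scaleN1r; apply: selfdualZ. Qed.

Lemma coord_Sigma_sum (a : 'I_3 -> R) k :
  ip2 G (Sigma G k) (\sum_i a i *: Sigma G i) = a k.
Proof.
rewrite linear_sum (bigD1 k) //= big1 => [|i /negPf ik].
  by rewrite linearZ /= Sigma_orthonormal // eqxx addr0 [LHS]mulr1.
by rewrite linearZ /= Sigma_orthonormal // eq_sym ik [LHS]mulr0.
Qed.

Lemma selfdual_eq s t : selfdual G s -> selfdual G t ->
  (forall i, ip2 G (Sigma G i) s = ip2 G (Sigma G i) t) -> s = t.
Proof.
move=> ssd tsd st; rewrite (Sigma_expand Gpos ssd) (Sigma_expand Gpos tsd).
by apply: eq_bigr => i _; rewrite st.
Qed.

Lemma cross_selfdual u v : selfdual G (cross G u v).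
Proof.
by apply: (subspace_sum subspace_selfdual) => i _; apply/selfdualZ/Sigma_selfdual.
Qed.

Lemma coord_cross u v k : let c w i := ip2 G (Sigma G i) w in
  c (cross G u v) k = c u (k + 1) * c v (k + 2%:R) - c u (k + 2%:R) * c v (k + 1).
Proof. exact: coord_Sigma_sum. Qed.

Lemma crossDl a s t v : cross G (a *: s + t) v = a *: cross G s v + cross G t v.
Proof.
rewrite /cross scaler_sumr -big_split; apply: eq_bigr => i _ /=.
rewrite scalerA -scalerDl !ip2Pr; congr (_ *: _).
have E (x y x' y' p q : R) :
    (a * x + x') * q - (a * y + y') * p = a * (x * q - y * p) + (x' * q - y' * p).
  by ring.
exact: E.
Qed.

Lemma cross0l v : cross G 0 v = 0.
Proof. by have := crossDl (-1) 0 0 v; rewrite scaler0 addr0 scaleN1r addNr. Qed.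

Lemma crossvv v : cross G v v = 0.
Proof.
apply: big1 => i _; have E (x y : R) (s : 'M[R]_4) : (x * y - y * x) *: s = 0.
  by rewrite mulrC subrr scale0r.
exact: E.
Qed.

Lemma cross0r v : cross G v 0 = 0.
Proof.
apply: big1 => i _; rewrite !ip20r.
have E (x y : R) (s : 'M[R]_4) : (x * 0 - y * 0) *: s = 0.
  by rewrite !mulr0 subrr scale0r.
exact: E.
Qed.

(** Write [T] as the sum of [t i (x) Sigma i].  Surjectivity of its endomorphism says
    that the 2-forms [t i] span [Lambda^+].  Contracting [T] with elements of
    [Lambda^+] in the form factor then yields every [Sigma j], because a left inverse
    [W] of the square matrix [M] of inner products of [t i] with the frame is also a
    right inverse. *)
Lemma endo_of_onto_span (T : form2 R) (P : 'M[R]_4 -> Prop) :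
  (forall k l, selfdual G (T k l)) ->
  (forall v, selfdual G v -> exists2 w, selfdual G w & endo_of G T w = v) ->
  linear_subspace P -> (forall k l, P (T k l)) ->
  forall v, selfdual G v -> P v.
Proof.
move=> Tsd Tonto PP PT v vsd.
have [w wsd wE] : exists2 w : 'I_3 -> 'M[R]_4, forall i, selfdual G (w i) &
    forall i, endo_of G T (w i) = Sigma G i.
  have /choice[w wP] : forall i, exists w, selfdual G w /\ endo_of G T w = Sigma G i.
    by move=> i; have [w] := Tonto _ (Sigma_selfdual Gpos i); exists w.
  by exists w => i; have [] := wP i.
pose t i := endo_of G T (Sigma G i).
pose W : 'M[R]_3 := \matrix_(i, j) ip2 G (Sigma G j) (w i).
pose M : 'M[R]_3 := \matrix_(i, j) ip2 G (Sigma G j) (t i).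
have wt i : \sum_j W i j *: t j = Sigma G i.
  rewrite -wE; apply/matrixP => k l; rewrite summxE mxE.
  rewrite [w i in RHS](Sigma_expand Gpos (wsd i)) linear_sum /=.
  by apply: eq_bigr => j _; rewrite linearZ /= !mxE.
have /mulmx1C MW : W *m M = 1%:M.
  apply/matrixP => i j; rewrite !mxE -(Sigma_orthonormal Gpos) ip2C // -(wt i).
  by rewrite linear_sum /=; apply: eq_bigr => k _; rewrite linearZ /= !mxE.
have PM k : P (\sum_i M i k *: Sigma G i).
  have [K KE] := ip2_sum G (Sigma G k).
  have -> : \sum_i M i k *: Sigma G i = \sum_a \sum_b K a b *: T b a.
    under eq_bigr => i _ do rewrite mxE KE scaler_suml.
    rewrite exchange_big; apply: eq_bigr => a _ /=.
    under eq_bigr => i _ do rewrite scaler_suml.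
    rewrite exchange_big; apply: eq_bigr => b _ /=.
    rewrite (Sigma_expand Gpos (Tsd b a)) scaler_sumr; apply: eq_bigr => i _.
    by rewrite scalerA mxE ip2C.
  by do 2![apply: (subspace_sum PP) => ? _]; apply: (subspaceZ PP).
have PSigma j : P (Sigma G j).
  have -> : Sigma G j = \sum_k W k j *: \sum_i M i k *: Sigma G i.
    under eq_bigr => k _ do rewrite scaler_sumr.
    rewrite exchange_big (bigD1 j) //= [X in _ = _ + X]big1 => [|i ij].
      rewrite addr0 -[LHS]scale1r; under eq_bigr => k _ do rewrite scalerA mulrC.
      rewrite -scaler_suml; congr (_ *: _).
      by have /matrixP/(_ j j) := MW; rewrite !mxE eqxx.
    under eq_bigr => k _ do rewrite scalerA mulrC.
    rewrite -scaler_suml.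
    have /matrixP/(_ i j) := MW; rewrite !mxE (negPf ij) => ->.
    by rewrite scale0r.
  by apply: (subspace_sum PP) => k _; apply: (subspaceZ PP).
rewrite (Sigma_expand Gpos vsd).
by apply: (subspace_sum PP) => k _; apply: (subspaceZ PP).
Qed.

Lemma cross_nondegenerate v : selfdual G v ->
  (forall w, selfdual G w -> cross G w v = 0) -> v = 0.
Proof.
move=> vsd v0; apply: selfdual_eq => //; first exact: selfdual0.
have E i k : ip2 G (Sigma G k) (cross G (Sigma G i) v) = 0.
  by rewrite v0 ?linear0 //; apply: Sigma_selfdual.
apply: ord3_ind; rewrite linear0.
- have := E t1 t2; rewrite coord_cross !addI3 !Sigma_orthonormal //=.
  by rewrite mul0r mul1r sub0r => /eqP; rewrite oppr_eq0 => /eqP.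
- have := E t2 t0; rewrite coord_cross !addI3 !Sigma_orthonormal //=.
  by rewrite mul0r mul1r sub0r => /eqP; rewrite oppr_eq0 => /eqP.
- have := E t0 t1; rewrite coord_cross !addI3 !Sigma_orthonormal //=.
  by rewrite mul0r mul1r sub0r => /eqP; rewrite oppr_eq0 => /eqP.
Qed.

Lemma rotation0 L : rotation G L -> L 0 = 0.
Proof.
case=> -[_ Llin] _ _; have := Llin 1 0 0 selfdual0 selfdual0.
by rewrite !scale1r addr0 => /(congr1 (fun s => s - L 0)); rewrite subrr addrK.
Qed.

(** Schur's lemma: [L] maps each [Sigma i] to a multiple of itself, as it commutes with
    the bracket by [Sigma i], and the three factors agree, as the brackets permute the
    frame.  The common factor is [1] or [-1] since [L] is isometric, and its cube is
    positive. *)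
Lemma rotation_central L : rotation G L ->
  (forall w u, selfdual G w -> selfdual G u -> cross G w (L u) = L (cross G w u)) ->
  forall s, selfdual G s -> L s = s.
Proof.
move=> Lrot Lad; have L0 := rotation0 Lrot; case: Lrot => -[Lsd Llin] Liso Ldet.
have Ssd := Sigma_selfdual Gpos; have Son := Sigma_orthonormal Gpos.
have [Q QE] : exists Q, forall i j, ip2 G (Sigma G i) (L (Sigma G j)) = Q i j by eexists.
have cross1 i : cross G (Sigma G i) (Sigma G (i + 1)) = Sigma G (i + 2%:R).
  apply: selfdual_eq => //; first exact: cross_selfdual.
  move=> k; rewrite coord_cross !Son.
  by move: i k; apply: ord3_ind; apply: ord3_ind;
    rewrite !addI3 /= ?(mul0r, mulr0, mul1r, subr0, subrr).
have Qdiag i k : ip2 G (Sigma G k) (cross G (Sigma G i) (L (Sigma G i))) = 0.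
  by rewrite Lad // crossvv L0 linear0.
have Qshift i k : ip2 G (Sigma G k) (cross G (Sigma G i) (L (Sigma G (i + 1))))
    = Q k (i + 2%:R).
  by rewrite Lad // cross1 QE.
have Qoff : (Q t1 t0 = 0 /\ Q t2 t0 = 0) /\ (Q t0 t1 = 0 /\ Q t2 t1 = 0) /\
    (Q t0 t2 = 0 /\ Q t1 t2 = 0).
  have D00 := Qdiag t0 t1; have D01 := Qdiag t0 t2.
  have D10 := Qdiag t1 t0; have D11 := Qdiag t1 t2.
  have D20 := Qdiag t2 t0; have D21 := Qdiag t2 t1.
  rewrite coord_cross !addI3 !Son /= !QE in D00.
  rewrite coord_cross !addI3 !Son /= !QE in D01.
  rewrite coord_cross !addI3 !Son /= !QE in D10.
  rewrite coord_cross !addI3 !Son /= !QE in D11.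
  rewrite coord_cross !addI3 !Son /= !QE in D20.
  rewrite coord_cross !addI3 !Son /= !QE in D21.
  by split; [split|split; split]; lra.
case: Qoff => -[Q10 Q20] [[Q01 Q21] [Q02 Q12]].
have Q12E : Q t1 t1 = Q t2 t2.
  have := Qshift t0 t2; rewrite coord_cross !addI3 !Son /= !QE; lra.
have Q20E : Q t2 t2 = Q t0 t0.
  have := Qshift t1 t0; rewrite coord_cross !addI3 !Son /= !QE; lra.
have LS i : L (Sigma G i) = Q t0 t0 *: Sigma G i.
  apply: selfdual_eq; [exact: Lsd|exact: selfdualZ|].
  move=> k; rewrite linearZ /= Son QE.
  suff -> : Q k i = Q t0 t0 * (k == i)%:R by [].
  by move: i k; apply: ord3_ind; apply: ord3_ind;
    rewrite /= ?mulr1n ?mulr0n ?(Q10, Q20, Q01, Q21, Q02, Q12, Q12E, Q20E, mulr0, mulr1).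
have Q1 : Q t0 t0 = 1.
  have QM : \matrix_(i < 3, j < 3) ip2 G (Sigma G i) (L (Sigma G j)) = \matrix_(i, j) Q i j.
    by apply/matrixP => i j; rewrite [LHS]mxE [RHS]mxE QE.
  move: Ldet; rewrite QM det3 !mxE Q10 Q20 Q01 Q21 Q02 Q12 Q12E Q20E.
  rewrite !(mul0r, mulr0, subr0, addr0) => Qpos.
  have := Liso _ _ (Ssd t0) (Ssd t0); rewrite Son LS ip2Zr ip2C // ip2Zr Son.
  rewrite mulr1 -expr2 => /eqP.
  rewrite -subr_eq0 subr_sqr_1 mulf_eq0 subr_eq0 addr_eq0 => /orP[/eqP //|/eqP Qm1].
  by move: Qpos; rewrite Qm1; lra.
move=> s ssd.
have Lsum (r : seq 'I_3) (a : 'I_3 -> R) :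
    L (\sum_(i <- r) a i *: Sigma G i) = \sum_(i <- r) a i *: Sigma G i.
  elim: r => [|i r IH]; first by rewrite big_nil.
  rewrite !big_cons Llin //; first by rewrite LS Q1 scale1r IH.
  by apply: (subspace_sum subspace_selfdual) => k _; apply: selfdualZ.
by rewrite (Sigma_expand Gpos ssd) Lsum.
Qed.

Lemma rotation_inj L s t : rotation G L -> selfdual G s -> selfdual G t ->
  L s = L t -> s = t.
Proof.
case=> -[Lsd Llin] Liso _ ssd tsd st.
apply: selfdual_eq => // i.
have Ssd := Sigma_selfdual Gpos i.
by rewrite -(Liso _ s) // -(Liso _ t) // st.
Qed.

End Posdef.
End FibreEndomorphisms.

(** * Smooth functions *)

Section SmoothFunctions.
Variable R : realType.
Local Notation E := 'rV[R]_4.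
Implicit Types (U : set E) (f g : E -> R).

(** The difference of [f] and [g] vanishes near [x], so its differential is zero. *)
Lemma near_eq_differentiable f g x :
  (\near x, f x = g x) -> differentiable f x -> differentiable g x.
Proof.
move=> fg df; pose e := g - f.
have -> : g = f + e by rewrite /e addrC subrK.
apply: differentiableD => //.
have e0 : \forall y \near x, e y = 0.
  by apply: filterS fg => y fgy; rewrite -[e y]/(g y - f y) fgy subrr.
have ex : e x = 0 by exact: nbhs_singleton e0.
have eo : e \o shift x = cst (e x) + (\0 : {linear E -> R}) +o_ 0 id.
  apply/eqaddoP => _/posnumP[eps].
  have : \forall h \near (0 : E), e (h + x) = 0.
    move: e0; rewrite (near_shift 0) /=; apply: filterS => h.
    by rewrite subr0.
  apply: filterS => h eh.
  by rewrite !fctE /= eh ex addr0 subrr normr0 mulr_ge0.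
have e'0 : 'd e x = \0 :> (E -> R).
  by apply: diff_unique eo => y; apply: cst_continuous.
by apply/diff_locallyP; rewrite e'0; split=> // y; apply: cst_continuous.
Qed.

Lemma near_eq_partial f g i x :
  (\near x, f x = g x) -> partial i f x = partial i g x.
Proof. exact: near_eq_derive. Qed.

(** Regularity of class C^n.  The product rule expresses the first derivatives of a
    product by products of functions of class C^n, so that closure under products,
    inverses and square roots follows by induction on [n]; the definition of
    [smooth_on] by lists of indices offers no such induction. *)
Fixpoint Cn n U f : Prop :=
  if n is n'.+1 then
    (forall x, U x -> differentiable f x) /\ (forall i, Cn n' U (partial i f))
  else True.

Lemma smooth_onP U f : smooth_on U f <-> forall n, Cn n U f.
Proof.
split=> [fs n|fC s].
  elim: n f fs => //= n IH f fs; split=> [x Ux|i]; first exact: (fs [::]).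
  by apply: IH => s x Ux; have := fs (rcons s i) x Ux; rewrite foldr_rcons.
elim/last_ind: s f fC => [|s i IH] f fC x Ux; first by have [+ _] := fC 1%N; apply.
by rewrite foldr_rcons; apply: IH => // n; have [_] := fC n.+1; apply.
Qed.

Lemma Cn_le n U f : Cn n.+1 U f -> Cn n U f.
Proof.
elim: n f => // n IH f [df pf]; split=> // i; exact/IH/pf.
Qed.

Section Open.
Variable U : set E.
Hypothesis U_open : open U.

Let eq_near f g x : (forall y, U y -> f y = g y) -> U x -> \near x, f x = g x.
Proof.
move=> fg Ux; have : nbhs x U by apply: open_nbhs_nbhs.
by apply: filterS => y; apply: fg.
Qed.

Lemma partial_eq_on f g i x :
  (forall y, U y -> f y = g y) -> U x -> partial i f x = partial i g x.
Proof. by move=> fg Ux; apply/near_eq_partial/eq_near. Qed.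

Lemma Cn_eq n f g : (forall y, U y -> f y = g y) -> Cn n U f -> Cn n U g.
Proof.
elim: n f g => // n IH f g fg [df pf]; split=> [x Ux|i].
  exact: near_eq_differentiable (eq_near fg Ux) (df x Ux).
by apply: IH (pf i) => y Uy; apply: partial_eq_on.
Qed.

Lemma Cn_cst n a : Cn n U (fun=> a).
Proof.
elim: n a => //= n IH a; split=> [x _|i]; first exact: differentiable_cst.
apply: Cn_eq (IH 0) => y _; rewrite /partial; exact/esym/derive_cst.
Qed.

Lemma partialD f g i x : differentiable f x -> differentiable g x ->
  partial i (fun y => f y + g y) x = partial i f x + partial i g x.
Proof. by move=> df dg; apply: deriveD; apply: diff_derivable. Qed.

Lemma partialM f g i x : differentiable f x -> differentiable g x ->
  partial i (fun y => f y * g y) x = partial i f x * g x + f x * partial i g x.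
Proof.
move=> df dg; rewrite /partial [LHS]deriveM; [|exact: diff_derivable..].
by rewrite addrC /GRing.scale /= (mulrC (g x)).
Qed.

Lemma CnD n f g : Cn n U f -> Cn n U g -> Cn n U (fun x => f x + g x).
Proof.
elim: n f g => // n IH f g [df pf] [dg pg]; split=> [x Ux|i].
  by apply: differentiableD; [apply: df|apply: dg].
apply: Cn_eq (IH _ _ (pf i) (pg i)) => y Uy.
by rewrite partialD //; [apply: df|apply: dg].
Qed.

Lemma CnM n f g : Cn n U f -> Cn n U g -> Cn n U (fun x => f x * g x).
Proof.
elim: n f g => // n IH f g Cf Cg; have [df pf] := Cf; have [dg pg] := Cg.
split=> [x Ux|i].
  by apply: differentiableM; [apply: df|apply: dg].
apply: Cn_eq (CnD (IH _ _ (pf i) (Cn_le Cg)) (IH _ _ (Cn_le Cf) (pg i))) => y Uy.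
by rewrite partialM //; [apply: df|apply: dg].
Qed.

Lemma CnV n f : (forall x, U x -> f x != 0) -> Cn n U f -> Cn n U (fun x => (f x)^-1).
Proof.
move=> f0; elim: n => // n IH Cf; have [df pf] := Cf; split=> [x Ux|i].
  by apply: differentiableV; [apply: df|apply: f0].
have CV := IH (Cn_le Cf).
apply: Cn_eq (CnM (CnM (Cn_cst n (-1)) (CnM CV CV)) (pf i)) => y Uy.
rewrite /partial [RHS]deriveV; [|exact: f0|exact/diff_derivable/df].
by rewrite /GRing.scale /= mulN1r -invfM -expr2.
Qed.

Lemma partial_sqrt f i x : differentiable f x -> 0 < f x ->
  partial i (fun y => Num.sqrt (f y)) x = (2 * Num.sqrt (f x))^-1 * partial i f x.
Proof.
move=> df f0; have sd := is_derive1_sqrt f0.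
have ds : differentiable (Num.sqrt : R -> R) (f x) by apply/derivable1_diffP.
rewrite /partial !deriveE //; last exact: (differentiable_comp df ds).
rewrite (diff_comp df ds) /= deriv1E //.
by rewrite derive1E (@derive_val _ _ _ _ _ _ _ sd) /GRing.scale /= mulrC.
Qed.

Lemma Cn_sqrt n f : (forall x, U x -> 0 < f x) -> Cn n U f ->
  Cn n U (fun x => Num.sqrt (f x)).
Proof.
move=> f0; elim: n => // n IH Cf; have [df pf] := Cf; split=> [x Ux|i].
  apply: (differentiable_comp (df x Ux)); apply/derivable1_diffP.
  by have [] := is_derive1_sqrt (f0 x Ux).
have Cs := IH (Cn_le Cf).
have s0 x : U x -> 2 * Num.sqrt (f x) != 0.
  by move=> Ux; rewrite mulf_neq0 // gt_eqF ?sqrtr_gt0 ?f0.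
apply: Cn_eq (CnM (CnV s0 (CnM (Cn_cst n 2) Cs)) (pf i)) => y Uy.
by rewrite partial_sqrt //; [apply: df|apply: f0].
Qed.

Lemma smooth_eq f g : (forall y, U y -> f y = g y) -> smooth_on U f -> smooth_on U g.
Proof. by move=> fg; rewrite !smooth_onP => Cf n; apply: Cn_eq (Cf n). Qed.

Lemma smooth_cst a : smooth_on U (fun=> a).
Proof. by rewrite smooth_onP => n; apply: Cn_cst. Qed.

Lemma smoothD f g : smooth_on U f -> smooth_on U g -> smooth_on U (fun x => f x + g x).
Proof. by rewrite !smooth_onP => Cf Cg n; apply: CnD. Qed.

Lemma smoothM f g : smooth_on U f -> smooth_on U g -> smooth_on U (fun x => f x * g x).
Proof. by rewrite !smooth_onP => Cf Cg n; apply: CnM. Qed.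

Lemma smoothN f : smooth_on U f -> smooth_on U (fun x => - f x).
Proof.
move=> sf; apply: smooth_eq (smoothM (smooth_cst (-1)) sf) => x _; exact: mulN1r.
Qed.

Lemma smoothB f g : smooth_on U f -> smooth_on U g -> smooth_on U (fun x => f x - g x).
Proof. by move=> sf sg; apply/smoothD/smoothN. Qed.

Lemma smoothV f : (forall x, U x -> f x != 0) ->
  smooth_on U f -> smooth_on U (fun x => (f x)^-1).
Proof. by move=> f0; rewrite !smooth_onP => Cf n; apply: CnV. Qed.

Lemma smooth_sqrt f : (forall x, U x -> 0 < f x) ->
  smooth_on U f -> smooth_on U (fun x => Num.sqrt (f x)).
Proof. by move=> f0; rewrite !smooth_onP => Cf n; apply: Cn_sqrt. Qed.

Lemma smooth_partial f i : smooth_on U f -> smooth_on U (partial i f).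
Proof. by rewrite !smooth_onP => Cf n; have [_ pf] := Cf n.+1; apply: pf. Qed.

Lemma smooth_sum I (r : seq I) (F : I -> E -> R) :
  (forall i, smooth_on U (F i)) -> smooth_on U (fun x => \sum_(i <- r) F i x).
Proof.
move=> sF; elim: r => [|i r IH].
  by apply: smooth_eq (smooth_cst 0) => x _; rewrite big_nil.
by apply: smooth_eq (smoothD (sF i) IH) => x _; rewrite big_cons.
Qed.

Lemma smooth_diff f x : smooth_on U f -> U x -> differentiable f x.
Proof. by move=> sf Ux; apply: (sf [::]). Qed.

End Open.
End SmoothFunctions.

(** * Smooth matrices and their derivatives *)

Section MatrixFunctions.
Variable R : realType.
Local Notation E := 'rV[R]_4.
Variable U : set E.
Hypothesis U_open : open U.

Lemma smooth_mxD m n (A B : E -> 'M[R]_(m, n)) :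
  smooth_mx_on U A -> smooth_mx_on U B -> smooth_mx_on U (fun x => A x + B x).
Proof.
move=> sA sB i j; apply: smooth_eq (smoothD U_open (sA i j) (sB i j)) => // x _.
by rewrite mxE.
Qed.

Lemma smooth_mxZ m n (f : E -> R) (A : E -> 'M[R]_(m, n)) :
  smooth_on U f -> smooth_mx_on U A -> smooth_mx_on U (fun x => f x *: A x).
Proof.
move=> sf sA i j; apply: smooth_eq (smoothM U_open sf (sA i j)) => // x _.
by rewrite mxE.
Qed.

Lemma smooth_mx_cst m n (A : 'M[R]_(m, n)) : smooth_mx_on U (fun=> A).
Proof. by move=> i j; apply: smooth_cst. Qed.

Lemma smooth_mxB m n (A B : E -> 'M[R]_(m, n)) :
  smooth_mx_on U A -> smooth_mx_on U B -> smooth_mx_on U (fun x => A x - B x).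
Proof.
move=> sA sB i j; apply: smooth_eq (smoothB U_open (sA i j) (sB i j)) => // x _.
by rewrite !mxE.
Qed.

Lemma smooth_mxM m n p (A : E -> 'M[R]_(m, n)) (B : E -> 'M[R]_(n, p)) :
  smooth_mx_on U A -> smooth_mx_on U B -> smooth_mx_on U (fun x => A x *m B x).
Proof.
move=> sA sB i j; have sAB k := smoothM U_open (sA i k) (sB k j).
by apply: smooth_eq (smooth_sum U_open _ sAB) => // x _; rewrite mxE.
Qed.

Lemma smooth_prod I (r : seq I) (F : I -> E -> R) :
  (forall i, smooth_on U (F i)) -> smooth_on U (fun x => \prod_(i <- r) F i x).
Proof.
move=> sF; elim: r => [|i r IH].
  by apply: smooth_eq (smooth_cst U_open 1) => // x _; rewrite big_nil.
by apply: (smooth_eq U_open) (smoothM U_open (sF i) IH) => x _; rewrite big_cons.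
Qed.

Lemma smooth_det n (A : E -> 'M[R]_n) :
  smooth_mx_on U A -> smooth_on U (fun x => \det (A x)).
Proof.
move=> sA; apply: (smooth_sum U_open) => s.
apply: (smoothM U_open); first exact: smooth_cst.
by apply: smooth_prod => i; apply: sA.
Qed.

Lemma smooth_mx_inv n (A : E -> 'M[R]_n) : (forall x, U x -> A x \in unitmx) ->
  smooth_mx_on U A -> smooth_mx_on U (fun x => invmx (A x)).
Proof.
move=> Au sA.
have d0 x : U x -> \det (A x) != 0 by move=> /Au; rewrite unitmxE unitfE.
have sadj : smooth_mx_on U (fun x => \adj (A x)).
  move=> i j; apply: smooth_eq; first exact: U_open.
    by move=> x _; rewrite mxE; reflexivity.
  apply: (smoothM U_open); first exact: smooth_cst.
  apply: smooth_det => k l; apply: smooth_eq (sA (lift j k) (lift i l)) => // x _.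
  by rewrite !mxE.
move=> i j; apply: smooth_eq (smooth_mxZ (smoothV U_open d0 (smooth_det sA)) sadj i j) => //.
by move=> x Ux; rewrite /invmx Au.
Qed.

Lemma smooth_dual (A : E -> 'M[R]_4) :
  smooth_mx_on U A -> smooth_mx_on U (fun x => dual (A x)).
Proof.
move=> sA.
apply: ord4_ind; apply: ord4_ind.
all: apply: smooth_eq; [exact: U_open|by move=> x _; rewrite mxE /=; reflexivity|].
all: by [apply: smooth_cst|apply: sA|apply: smoothN].
Qed.

Definition mpartial (i : 'I_4) (A : E -> 'M[R]_4) (x : E) : 'M[R]_4 :=
  \matrix_(k, l) partial i (fun y => A y k l) x.

Lemma partial_cst (a : R) i x : partial i (fun=> a) x = 0.
Proof. exact: derive_cst. Qed.

Lemma partial_sum I (r : seq I) (F : I -> E -> R) i x :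
  U x -> (forall k, smooth_on U (F k)) ->
  partial i (fun y => \sum_(k <- r) F k y) x = \sum_(k <- r) partial i (F k) x.
Proof.
move=> Ux sF; elim: r => [|k r IH].
  rewrite big_nil -[RHS](partial_cst 0 i x).
  by apply: (partial_eq_on U_open) => // y _; rewrite big_nil.
rewrite big_cons -IH -partialD.
- by apply: (partial_eq_on U_open) => // y _; rewrite big_cons.
- exact: smooth_diff (sF k) Ux.
- exact: smooth_diff (smooth_sum U_open r sF) Ux.
Qed.

Lemma mpartial_eq_on i A B x : (forall y, U y -> A y = B y) -> U x ->
  mpartial i A x = mpartial i B x.
Proof.
move=> AB Ux; apply/matrixP => k l; rewrite !mxE.
by apply: (partial_eq_on U_open) => // y Uy; rewrite AB.
Qed.

Lemma mpartialM i A B x : smooth_mx_on U A -> smooth_mx_on U B -> U x ->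
  mpartial i (fun y => A y *m B y) x = mpartial i A x *m B x + A x *m mpartial i B x.
Proof.
move=> sA sB Ux; apply/matrixP => k l; rewrite !mxE -big_split /=.
rewrite (partial_eq_on U_open (g := fun y => \sum_m A y k m * B y m l)) //; last first.
  by move=> y _; rewrite mxE.
rewrite partial_sum // => [|m]; last exact: smoothM.
apply: eq_bigr => m _; rewrite !mxE partialM //.
  exact: smooth_diff (sA k m) Ux.
exact: smooth_diff (sB m l) Ux.
Qed.

Lemma mpartialZ i f A x : smooth_on U f -> smooth_mx_on U A -> U x ->
  mpartial i (fun y => f y *: A y) x = partial i f x *: A x + f x *: mpartial i A x.
Proof.
move=> sf sA Ux; apply/matrixP => k l; rewrite !mxE.
rewrite -partialM; [|exact: smooth_diff sf Ux|exact: smooth_diff (sA k l) Ux].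
by apply: (partial_eq_on U_open) => // y _; rewrite mxE.
Qed.

Lemma partialN f i x : smooth_on U f -> U x ->
  partial i (fun y => - f y) x = - partial i f x.
Proof.
move=> sf Ux; rewrite (partial_eq_on U_open (g := fun y => (-1) * f y)) //; last first.
  by move=> y _; rewrite mulN1r.
rewrite partialM; [|exact: differentiable_cst|exact: smooth_diff sf Ux].
by rewrite partial_cst mul0r add0r mulN1r.
Qed.

Lemma mpartial_dual i A x : smooth_mx_on U A -> U x ->
  mpartial i (fun y => dual (A y)) x = dual (mpartial i A x).
Proof.
move=> sA Ux; apply/matrixP; apply: ord4_ind; apply: ord4_ind.
all: rewrite !mxE /= ?mxE -?partialN //.
all: try by apply: (partial_eq_on U_open) => // y _; rewrite mxE.
all: rewrite -[RHS](partial_cst 0 i x).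
all: by apply: (partial_eq_on U_open) => // y _; rewrite mxE.
Qed.

Lemma mpartial_antisym i A x : smooth_mx_on U A ->
  (forall y, U y -> (A y)^T = - A y) -> U x -> (mpartial i A x)^T = - mpartial i A x.
Proof.
move=> sA AN Ux; apply/matrixP => k l; rewrite !mxE -partialN //.
apply: (partial_eq_on U_open) => // y Uy.
by have /matrixP/(_ k l) := AN y Uy; rewrite !mxE.
Qed.

End MatrixFunctions.

(** * The Levi-Civita connection on self-dual forms *)

Section CovariantDerivative.
Variable R : realType.
Implicit Types (s t u v w X P G Th : 'M[R]_4).

Lemma cancel_terms (A B C D1 D2 s w : 'M[R]_4) (p t d : R) :
  p *: B + D1 + (A + t *: s - D1 - D2) + (D2 + p *: C)
    = d *: s + p *: (w + (B + C)) ->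
  A = p *: w + (d - t) *: s.
Proof.
move=> H; apply/matrixP => i j; move/matrixP/(_ i j): H.
by rewrite !(entD, entN, entZ); lra.
Qed.

(** Here [X *m G + G *m X^T], [ds] and [dphi] stand for the derivatives of the metric
    [G], of [s] and of [phi], the square root of [\det G], and
    [w = ds - X *m s - s *m X^T] for the covariant derivative of [s].  Differentiating
    [G *m dual s *m G = phi *: s] gives [G *m dual w *m G = phi *: w + k *: s] with
    [k = dphi - \tr X * phi].  Jacobi's formula would give [k = 0]; instead, applying
    the star twice, which is the identity, yields [k *: s = 0]. *)
Lemma selfdual_covariant G X s ds (dphi : R) : posdef G -> selfdual G s ->
  ds^T = - ds ->
  (X *m G + G *m X^T) *m dual s *m G + G *m dual ds *m G
    + G *m dual s *m (X *m G + G *m X^T)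
  = dphi *: s + Num.sqrt (\det G) *: ds ->
  selfdual G (ds - X *m s - s *m X^T).
Proof.
move=> Gpos /(selfdualE _ Gpos)[sN sE] dsN; have Gsym := proj1 Gpos.
have phi0 : 0 < Num.sqrt (\det G) by rewrite sqrtr_gt0 posdef_det.
have phi2 : Num.sqrt (\det G) * Num.sqrt (\det G) = \det G.
  by rewrite -expr2 sqr_sqrtr // ltW // posdef_det.
move: (Num.sqrt (\det G)) sE phi0 phi2 => phi sE phi0 phi2.
set w := ds - _ - _.
have LN : (X *m s + s *m X^T)^T = - (X *m s + s *m X^T).
  by rewrite [LHS]linearD /= !trmx_mul trmxK sN mulmxN mulNmx opprD addrC.
have dsE : ds = w + (X *m s + s *m X^T) by rewrite /w -[ds - _ - _]addrA -opprD subrK.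
have wN : w^T = - w.
  have -> : w = ds + (-1) *: (X *m s + s *m X^T) by rewrite scaleN1r dsE addrK.
  by apply: antisymD => //; apply: antisymZ.
set T1 := G *m X^T *m dual s *m G; set T2 := G *m dual s *m X *m G.
have e1 : (X *m G + G *m X^T) *m dual s *m G = phi *: (X *m s) + T1.
  by rewrite 2!mulmxDl; congr (_ + _); rewrite scalemxAr -sE !mulmxA.
have e2 : G *m dual s *m (X *m G + G *m X^T) = T2 + phi *: (s *m X^T).
  by rewrite mulmxDr !mulmxA; congr (_ + _); rewrite scalemxAl -sE.
have e3 : G *m dual ds *m G = G *m dual w *m G + (\tr X * phi) *: s - T1 - T2.
  rewrite dsE dualD dual_lie // mulmxDr mulmxDl !mulmxBr !mulmxBl.
  by rewrite -scalemxAr -scalemxAl sE scalerA !mulmxA -/T1 -/T2 !addrA.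
rewrite e1 e2 e3 {1}dsE => H.
pose k := dphi - \tr X * phi.
have wE : G *m dual w *m G = phi *: w + k *: s.
  exact: cancel_terms H.
have ks0 : k *: s = 0.
  have := dual_congr G (dual_antisym w); rewrite Gsym wE dualK //.
  rewrite dualD !dualZ mulmxDr mulmxDl -!(scalemxAl, scalemxAr) sE wE -phi2.
  rewrite scalerDr !scalerA -addrA -[RHS]addr0 => /addrI/eqP.
  rewrite (mulrC k) -scalerDl -mulr2n -mulrnAl -scalerA scaler_eq0 mulrn_eq0 /=.
  by rewrite gt_eqF //= => /eqP.
apply/selfdualE => //; split=> //; rewrite wE ks0 addr0.
by rewrite -phi2 -expr2 sqrtr_sqr gtr0_norm.
Qed.

End CovariantDerivative.

Section Metric.
Variables (R : realType) (M : oriented_manifold4 R) (g : tensor2 M).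
Hypothesis g_riemannian : riemannian g.
Local Notation E := 'rV[R]_4.
Variable c : chart_index M.
Local Notation U := (chart_image c).

Lemma chart_open : open U.
Proof. exact: image_open. Qed.

Lemma g_smooth : smooth_mx_on U (g c).
Proof. by case: g_riemannian. Qed.

Lemma g_posdef x : U x -> posdef (g c x).
Proof. by case: g_riemannian => _ + _; apply. Qed.

Lemma g_inv_smooth : smooth_mx_on U (fun x => invmx (g c x)).
Proof.
apply: (smooth_mx_inv chart_open); first by move=> x /g_posdef/posdef_unit.
exact: g_smooth.
Qed.

Lemma volume_smooth : smooth_on U (fun x => Num.sqrt (\det (g c x))).
Proof.
apply: (smooth_sqrt chart_open); first by move=> x /g_posdef/posdef_det.
exact: (smooth_det chart_open g_smooth).
Qed.

(** Twice the Christoffel symbols of the first kind. *)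
Definition lowered_christoffel (i : 'I_4) (x : E) : 'M[R]_4 := \matrix_(m, j)
  (partial i (fun y => g c y m j) x + partial j (fun y => g c y m i) x
   - partial m (fun y => g c y i j) x).

(** The matrix [X] of the connection on covectors in the coordinate coframe, for which
    [Gamma] is [v |-> dv - X *m v - v *m X^T]. *)
Definition connection_mx (i : 'I_4) (x : E) : 'M[R]_4 :=
  2^-1 *: ((lowered_christoffel i x)^T *m invmx (g c x)).

Lemma connection_mxE i x m k : U x ->
  connection_mx i x k m = christoffel g c x m i k.
Proof.
move=> Ux; rewrite !mxE /christoffel; congr (_ * _); apply: eq_bigr => p _.
have Gsym := proj1 (g_posdef Ux).
by rewrite !mxE mulrC -{1}(invmx_sym Gsym) mxE.
Qed.

Lemma connection_mx_smooth i : smooth_mx_on U (connection_mx i).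
Proof.
apply: (smooth_mxZ chart_open); first exact: smooth_cst chart_open _.
apply: (smooth_mxM chart_open); last exact: g_inv_smooth.
have sp k m j := smooth_partial k (g_smooth m j).
move=> j m; apply: (smooth_eq chart_open) (smoothB chart_open
  (smoothD chart_open (sp i m j) (sp j m i)) (sp m i j)) => x _.
by rewrite !mxE.
Qed.

Lemma metric_compatible i x : U x ->
  mpartial i (g c) x = connection_mx i x *m g c x + g c x *m (connection_mx i x)^T.
Proof.
move=> Ux; have Gsym := proj1 (g_posdef Ux); have Gu := posdef_unit (g_posdef Ux).
have XG : connection_mx i x *m g c x = 2^-1 *: (lowered_christoffel i x)^T.
  by rewrite -scalemxAl mulmxKV.
have GX : g c x *m (connection_mx i x)^T = 2^-1 *: lowered_christoffel i x.
  rewrite -[LHS]trmxK trmx_mul trmxK Gsym XG.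
  by rewrite linearZ /= trmxK.
rewrite XG GX -scalerDr; apply/matrixP => k l; rewrite !mxE.
have gC j a b : partial j (fun y => g c y a b) x = partial j (fun y => g c y b a) x.
  apply: (partial_eq_on chart_open) => // y Uy.
  by rewrite -{1}(proj1 (g_posdef Uy)) mxE.
by rewrite (gC i l k) (gC k l i) (gC l i k); lra.
Qed.

Lemma GammaE i (v : E -> 'M[R]_4) x : U x -> Gamma g c i v x =
  mpartial i v x - connection_mx i x *m v x - v x *m (connection_mx i x)^T.
Proof.
move=> Ux; apply/matrixP => k l; rewrite !mxE; congr (_ - _ - _).
  by apply: eq_bigr => m _; rewrite connection_mxE.
by apply: eq_bigr => m _; rewrite [in RHS]mxE connection_mxE // mulrC.
Qed.

(** [Lambda^+] is invariant since the metric that defines the star is parallel. *)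
Lemma Gamma_section i v : local_section g c v -> local_section g c (Gamma g c i v).
Proof.
case=> sv vsd; split=> [|x Ux].
  have sX := connection_mx_smooth i.
  have sXt : smooth_mx_on U (fun x => (connection_mx i x)^T).
    by move=> k l; apply: (smooth_eq chart_open) (sX l k) => y _; rewrite [RHS]mxE.
  have sdv : smooth_mx_on U (mpartial i v).
    move=> k l; apply: (smooth_eq chart_open) (smooth_partial i (sv k l)) => y _.
    by rewrite mxE.
  have sG := smooth_mxB chart_open (smooth_mxB chart_open sdv
    (smooth_mxM chart_open sX sv)) (smooth_mxM chart_open sv sXt).
  by move=> k l; apply: (smooth_eq chart_open) (sG k l) => y Uy; rewrite GammaE.
have Gpos := g_posdef Ux.
have vN y : U y -> (v y)^T = - v y by move=> /vsd[].
have dvN := mpartial_antisym chart_open i sv vN Ux.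
have sg := g_smooth; have sdual := smooth_dual chart_open sv.
pose phi y := Num.sqrt (\det (g c y)).
have phiZ : mpartial i (fun y => phi y *: v y) x =
    partial i phi x *: v x + Num.sqrt (\det (g c x)) *: mpartial i v x.
  exact: (mpartialZ chart_open i volume_smooth sv Ux).
rewrite (GammaE i v Ux).
apply: (selfdual_covariant (dphi := partial i phi x) Gpos (vsd x Ux) dvN).
rewrite -(metric_compatible i Ux) -phiZ.
rewrite (mpartial_eq_on chart_open i
  (A := fun y => phi y *: v y) (B := fun y => g c y *m dual (v y) *m g c y) _ Ux);
  last first.
  move=> y Uy; have [_ E] := (selfdualE _ (g_posdef Uy)).1 (vsd y Uy).
  exact: esym E.
rewrite (mpartialM chart_open i (smooth_mxM chart_open sg sdual) sg Ux).
by rewrite (mpartialM chart_open i sg sdual Ux) (mpartial_dual chart_open i sv Ux) mulmxDl.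
Qed.

Lemma section0 : local_section g c (fun=> 0).
Proof.
by split=> [|x Ux]; [exact: (smooth_mx_cst chart_open 0)|exact/selfdual0/g_posdef].
Qed.

Lemma section_opp v : local_section g c v -> local_section g c (fun x => - v x).
Proof.
case=> sv vsd; split=> [k l|x Ux].
  apply: (smooth_eq chart_open) (smoothN chart_open (sv k l)) => x _.
  by rewrite mxE.
by apply: selfdualN; [exact: g_posdef|exact: vsd].
Qed.

Lemma section_add u v : local_section g c u -> local_section g c v ->
  local_section g c (fun x => u x + v x).
Proof.
case=> su usd [sv vsd]; split=> [|x Ux]; first exact: (smooth_mxD chart_open).
by apply: selfdualD; [exact: g_posdef|exact: usd|exact: vsd].
Qed.

(** The frame in the definition of [cross] need not be continuous in [x]; smoothness is
    read off from [cross_commutator]. *)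
Lemma section_cross u v : local_section g c u -> local_section g c v ->
  local_section g c (fun x => cross (g c x) (u x) (v x)).
Proof.
case=> su usd [sv vsd]; split=> [|x Ux]; last first.
  by apply: cross_selfdual; apply: g_posdef.
have si := g_inv_smooth; have sm := smooth_mxM chart_open.
have sc := smooth_mxZ chart_open (smooth_cst chart_open (Num.sqrt 2)^-1)
  (smooth_mxB chart_open (sm _ _ _ _ _ (sm _ _ _ _ _ su si) sv)
                         (sm _ _ _ _ _ (sm _ _ _ _ _ sv si) su)).
move=> k l; apply: (smooth_eq chart_open) (sc k l) => x Ux.
by rewrite cross_commutator //; [exact: g_posdef|exact: usd|exact: vsd].
Qed.

(** The self-dual projection of a form with constant coefficients. *)
Lemma section_through x s : U x -> selfdual (g c x) s ->
  exists2 v, local_section g c v & v x = s.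
Proof.
move=> Ux ssd; have [sN _] := ssd.
pose phi y := Num.sqrt (\det (g c y)).
have phi0 y : U y -> 0 < phi y by move=> Uy; rewrite sqrtr_gt0; apply/posdef_det/g_posdef.
pose v y := 2^-1 *: (s + (phi y)^-1 *: (g c y *m dual s *m g c y)).
have phiV : smooth_on U (fun y => (phi y)^-1).
  apply: (smoothV chart_open) volume_smooth => y Uy.
  by rewrite gt_eqF // phi0.
exists v; last first.
  have [_ E] := (selfdualE _ (g_posdef Ux)).1 ssd.
  rewrite /v E scalerA mulVf ?gt_eqF ?phi0 // scale1r.
  have -> : s + s = 2 *: s by rewrite scaler_nat mulr2n.
  by rewrite scalerA mulVf ?scale1r // pnatr_eq0.
split=> [|y Uy].
  apply: (smooth_mxZ chart_open); first exact: smooth_cst chart_open _.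
  apply: (smooth_mxD chart_open); first exact: (smooth_mx_cst chart_open s).
  apply: (smooth_mxZ chart_open) => //.
  apply: (smooth_mxM chart_open) g_smooth.
  by apply: (smooth_mxM chart_open) g_smooth _; exact: (smooth_mx_cst chart_open (dual s)).
have Gpos := g_posdef Uy; have Gsym := proj1 Gpos.
have starN : (g c y *m dual s *m g c y)^T = - (g c y *m dual s *m g c y).
  by rewrite -{2 4}Gsym congr_antisym // dual_antisym.
apply/selfdualE => //; split.
  by apply/antisymZ/antisymD => //; apply: antisymZ.
rewrite -/(phi y) /v dualZ dualD dualZ -scalemxAr -scalemxAl scalerA mulrC -scalerA.
congr (_ *: _); rewrite mulmxDr mulmxDl -scalemxAr -scalemxAl.
have := dual_congr (g c y) (dual_antisym s); rewrite Gsym dualK // => ->.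
rewrite scalerDr !scalerA mulfV ?gt_eqF ?phi0 // scale1r addrC; congr (_ *: _ + _).
apply: (mulfI (lt0r_neq0 (phi0 y Uy))); rewrite mulVKf ?gt_eqF ?phi0 //.
by rewrite -expr2 sqr_sqrtr // ltW // posdef_det.
Qed.

End Metric.

(** * Connections on self-dual forms and their curvature *)

Section Connections.
Variables (R : realType) (M : oriented_manifold4 R) (g : tensor2 M).
Hypothesis g_riemannian : riemannian g.
Local Notation E := 'rV[R]_4.

Section Chart.
Variables (a : form1_field M) (c : chart_index M).
Hypothesis a_section : forall i, local_section g c (fun x => a c x i).
Local Notation U := (chart_image c).
Local Notation A := (add_form g (Gamma g) a).

Lemma connection_eq_on i (u v : E -> 'M[R]_4) x : U x ->
  (forall y, U y -> u y = v y) -> A c i u x = A c i v x.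
Proof.
move=> Ux uv; have gr := g_riemannian.
rewrite /add_form (GammaE gr i u Ux) (GammaE gr i v Ux) (uv x Ux).
by rewrite (mpartial_eq_on (chart_open (c := c)) i uv Ux).
Qed.

Lemma connection0 i x : U x -> A c i (fun=> 0) x = 0.
Proof.
move=> Ux; rewrite /add_form (GammaE g_riemannian i _ Ux) cross0r addr0 mulmx0 mul0mx !subr0.
by apply/matrixP => k l; rewrite !mxE -[RHS](partial_cst 0 i x); congr partial;
  apply/funext => y; rewrite mxE.
Qed.

Lemma connection_section i v : local_section g c v -> local_section g c (A c i v).
Proof.
move=> sv; apply: (section_add g_riemannian); first exact: Gamma_section.
exact: (section_cross g_riemannian).
Qed.

(** Both alternatives serve below, since the default value [0] commutes with
    everything. *)
Lemma curvatureP x i j : U x ->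
  curvature g A c x i j = 0 \/
  selfdual (g c x) (curvature g A c x i j) /\
  forall v, local_section g c v ->
    d1 A c (d0 A c v) x i j = cross (g c x) (curvature g A c x i j) (v x).
Proof.
move=> Ux; rewrite /curvature; case: xgetP => [w _ wP|_]; [by right|by left].
Qed.

Lemma curvature_selfdual x i j : U x -> selfdual (g c x) (curvature g A c x i j).
Proof.
move=> Ux; have [->|[]//] := curvatureP i j Ux.
exact/selfdual0/(g_posdef g_riemannian).
Qed.

(** The second covariant derivatives of [f] vanish, and their commutator is the action
    of the curvature. *)
Lemma curvature_parallel f x i j : local_section g c f ->
  (forall y k, U y -> A c k f y = 0) -> U x ->
  cross (g c x) (curvature g A c x i j) (f x) = 0.
Proof.
move=> sf f0 Ux; have [->|[_ <-//]] := curvatureP i j Ux; first exact: cross0l.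
rewrite /d1 /d0.
rewrite (connection_eq_on i (v := fun=> 0) Ux) => [|y Uy]; last exact: f0.
rewrite (connection_eq_on j (v := fun=> 0) Ux) => [|y Uy]; last exact: f0.
by rewrite !connection0 // subr0.
Qed.

(** A transformation that fixes the connection commutes with first covariant
    derivatives of sections, hence with second ones, hence with the curvature. *)
Lemma curvature_commutes (r : endo_field M) x i j s :
  gauge_transformation g r -> eq_connection g (gauge_act g r A) A ->
  U x -> selfdual (g c x) s ->
  cross (g c x) (curvature g A c x i j) (r c x s) =
  r c x (cross (g c x) (curvature g A c x i j) s).
Proof.
move=> [[r_endo r_smooth _] r_rot] rA Ux ssd.
have gpos := g_posdef g_riemannian (c := c).
have r0 y : U y -> r c y 0 = 0 by move=> Uy; apply: rotation0 (r_rot c y Uy); apply: gpos.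
have [->|[_ FE]] := curvatureP i j Ux; first by rewrite !cross0l r0.
(* the action of the curvature on [s] is known through sections *)
have [v sv <-] := section_through g_riemannian Ux ssd.
have r_section u : local_section g c u -> local_section g c (fun y => r c y (u y)).
  move=> su; split; first exact: r_smooth.
  by move=> y Uy; apply: (r_endo c y Uy).1; apply: su.2.
have rAE k u y : local_section g c u -> U y ->
    A c k (fun y => r c y (u y)) y = r c y (A c k u y).
  move=> su Uy; have sru := r_section u su.
  rewrite -(rA c _ sru k y Uy) /gauge_act; congr (r c y _).
  apply: connection_eq_on => // z Uz; rewrite /endo_inv.
  apply: xget_subset1; first by split=> //; apply: su.2.
  move=> s1 s2 [s1sd s1E] [s2sd s2E].
  by apply: (rotation_inj (gpos z Uz) (r_rot c z Uz)) => //; rewrite s1E s2E.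
have AA k l y : U y ->
    A c k (fun z => A c l (fun z => r c z (v z)) z) y = r c y (A c k (A c l v) y).
  move=> Uy; rewrite -(rAE k _ y (connection_section l sv) Uy).
  by apply: (connection_eq_on k Uy) => z Uz; apply: (rAE l v z sv Uz).
rewrite -(FE _ (r_section v sv)) -(FE v sv) /d1 /d0 (AA i j x Ux) (AA j i x Ux).
have sA k l : selfdual (g c x) (A c k (A c l v) x).
  by apply: (connection_section k (connection_section l sv)).2.
have [_ r_lin] := r_endo c x Ux.
by rewrite addrC -scaleN1r -(r_lin _ _ _ (sA j i) (sA i j)) scaleN1r addrC.
Qed.

End Chart.

End Connections.

(** * Solutions of Phi(h) = 0 *)

Section Main.
Variables (R : realType) (M : oriented_manifold4 R) (g : tensor2 M).
Hypothesis g_riemannian : riemannian g.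
Variables (h : endo_field M).
Hypothesis Phi_h : forall (c : chart_index M) (x : 'rV[R]_4) (v : 'M[R]_4),
  chart_image c x -> selfdual (g c x) v -> Phi g h c x v = 0.

Lemma ad_inv_section (T : chart_index M -> 'rV[R]_4 -> form3 R) c i :
  local_section g c (fun x => ad_inv g h T c x i).
Proof.
rewrite /ad_inv; case: xgetP => [a _ [[sa _] _]|_]; first exact: sa.
exact: section0.
Qed.

Lemma ad_inv_opp_section (T : chart_index M -> 'rV[R]_4 -> form3 R) c i :
  local_section g c (fun x => - ad_inv g h T c x i).
Proof. exact (section_opp g_riemannian (ad_inv_section T c i)). Qed.

(** [Phi h = 0] says that [F^+] maps [endo_inv h v] to [v], so [F^+] is onto, and its
    components are linear combinations of those of [F]. *)
Lemma curvature_spans c x (P : 'M[R]_4 -> Prop) :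
  chart_image c x -> linear_subspace P ->
  (forall i j, P (curvature g (A_of g h) c x i j)) ->
  forall v, selfdual (g c x) v -> P v.
Proof.
move=> Ux PP PF; have Gpos := g_posdef g_riemannian Ux.
have Fsd i j : selfdual (g c x) (curvature g (A_of g h) c x i j).
  exact: (curvature_selfdual g_riemannian _ i j Ux).
apply: (endo_of_onto_span Gpos (T := sd_part (g c x) (curvature g (A_of g h) c x))) => //.
- by move=> k l; apply: subspace_sd_part => //; apply: subspace_selfdual.
- move=> v vsd; exists (endo_inv (g c x) (h c x) v).
    by rewrite /endo_inv; case: xgetP => [s _ []|_] //; apply: selfdual0.
  by have /eqP := Phi_h Ux vsd; rewrite /Phi subr_eq0 => /eqP.
- by move=> k l; apply: subspace_sd_part.
Qed.

Lemma A_irreducible : irreducible g (A_of g h).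
Proof.
move=> f [sf _] f0 c x Ux; have Gpos := g_posdef g_riemannian Ux.
apply: (cross_nondegenerate Gpos); first by have [_ ] := sf c; apply.
apply: (curvature_spans Ux).
  split=> [|a s t s0 t0]; first exact: cross0l.
  by rewrite crossDl s0 t0 scaler0 addr0.
move=> i j; apply: (curvature_parallel g_riemannian i j (sf c) _ Ux) => y k Uy.
exact: f0.
Qed.

Lemma A_trivial_stabilizer : trivial_stabilizer g (A_of g h).
Proof.
move=> r r_gauge rA c x s Ux ssd; have Gpos := g_posdef g_riemannian Ux.
have rrot := r_gauge.2 c x Ux; have [[_ r_lin] _ _] := rrot.
apply: (rotation_central Gpos rrot) => // w u wsd usd.
move: w wsd u usd; apply: (curvature_spans Ux).
  split=> [u usd|a s1 s2 s1P s2P u usd]; first by rewrite !cross0l (rotation0 Gpos rrot).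
  rewrite !crossDl s1P // s2P // r_lin //; exact: cross_selfdual.
move=> i j u usd; apply: (curvature_commutes g_riemannian _ i j r_gauge rA Ux usd) => k.
exact: ad_inv_opp_section.
Qed.

End Main.

Theorem corollary2p12 (R : realType) (M : oriented_manifold4 R)
    (M_compact : compact [set: M]) (M_connected : connected [set: M])
    (g : tensor2 M) (g_riemannian : riemannian g)
    (h : endo_field M) (h_positive : positive_sym2_section g h)
    (Phi_h : forall (c : chart_index M) (x : 'rV[R]_4) (v : 'M[R]_4),
       chart_image c x -> selfdual (g c x) v -> Phi g h c x v = 0) :
  irreducible g (A_of g h) /\ trivial_stabilizer g (A_of g h).
Proof. by split; [apply: A_irreducible | apply: A_trivial_stabilizer]. Qed.
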